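(* Let $\tau\in\mathbb{C}$ with $\mathrm{Im}\,\tau>0$, let $T=\mathbb{C}/(\mathbb{Z}+\mathbb{Z}\tau)$, and let $\iota,\iota':T\to\mathbb{P}^n(\mathbb{C})$ be two embeddings of degree $n+1$ such that neither $\iota(T)$ nor $\iota'(T)$ is contained in any hyperplane of $\mathbb{P}^n$. Then there exist a translation $\sigma:T\to T$ and a projective linear transformation $G\in\mathrm{PGL}(n+1)$ such that $G\circ\iota=\iota'\circ\sigma$.
   Context: The degree of an embedding $\iota:T\to\mathbb{P}^n$ is the degree of the line bundle $\iota^*\mathcal{O}_{\mathbb{P}^n}(1)$ on $T$. A translation of $T$ is a map $u\mapsto u+a$ for some fixed $a\in T$, with respect to the group law of $T=\mathbb{C}/(\mathbb{Z}+\mathbb{Z}\tau)$. $\mathrm{PGL}(n+1)=\mathrm{PGL}(n+1,\mathbb{C})$ acts on $\mathbb{P}^n=\mathbb{P}^n(\mathbb{C})$. *)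

(* Defs.v *)
From HB Require Import structures.
From mathcomp Require Import all_boot all_order all_algebra.
From mathcomp Require Import generic_quotient ring_quotient complex.
From mathcomp Require Import all_classical all_reals all_analysis.
Import Order.TTheory GRing.Theory Num.Theory.
Import numFieldNormedType.Exports.

Set Implicit Arguments.
Unset Strict Implicit.
Unset Printing Implicit Defensive.

Local Open Scope classical_set_scope.
Local Open Scope ring_scope.
Local Open Scope quotient_scope.

(* Typing R[i] as a numClosedFieldType gives it the topology of its norm, and
   makes [derivable] over it complex differentiability. *)
Definition CC (R : realType) : numClosedFieldType := R[i].

Section Torus.
Context {R : realType}.
Variable tau : CC R.

Definition lattice : {pred CC R} :=
  fun z => `[< exists m n : int, z = m%:~R + n%:~R * tau >].

Lemma lattice_zmod_closed : zmod_closed lattice.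
Proof.
split=> [|x y]; first by apply/asboolP; exists 0, 0; rewrite mul0r addr0.
move=> /asboolP[m [n ->]] /asboolP[p [q ->]]; apply/asboolP.
exists (m - p), (n - q); rewrite !intrB mulrBl opprD.
by rewrite !addrA; congr (_ + _); rewrite addrAC.
Qed.

HB.instance Definition _ :=
  GRing.isZmodClosed.Build (CC R) lattice lattice_zmod_closed.

Definition torus : Type := Quotient.quot lattice.

HB.instance Definition _ := GRing.Zmodule.on torus.
HB.instance Definition _ := Quotient.on torus.

(* The topology is that of [quotient_topology]; that alias cannot be used
   directly because it changes the choiceType under the zmodType. *)
Definition torus_open (U : set torus) : Prop := open (\pi_torus @^-1` U).

Lemma torus_openT : torus_open setT.
Proof. by rewrite /torus_open preimage_setT; exact: openT. Qed.

Lemma torus_openI U V : torus_open U -> torus_open V -> torus_open (U `&` V).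
Proof. exact: openI. Qed.

Lemma torus_open_bigcup (I : Type) (U : I -> set torus) :
  (forall i, torus_open (U i)) -> torus_open (\bigcup_i U i).
Proof. by move=> oU; apply: bigcup_open => i _; exact: oU. Qed.

HB.instance Definition _ :=
  isOpenTopological.Build torus torus_openT torus_openI torus_open_bigcup.

Definition is_translation (sigma : torus -> torus) : Prop :=
  exists a : torus, sigma = fun u => u + a.

(* The charts of the torus are the local inverses of the projection from CC R,
   so local notions are tested on the composition with that projection. *)
Definition holomorphic_on (U : set torus) (f : torus -> CC R) : Prop :=
  forall z : CC R, U (\pi_torus z) -> derivable (f \o \pi_torus) z 1.

End Torus.

Section ProjectiveSpace.
Context {R : realType} {n : nat}.
Local Notation C := (CC R).

Definition proportional (v w : 'cV[C]_n.+1) : Prop :=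
  exists2 c : C, c != 0 & v = c *: w.

Lemma proportional_refl v : proportional v v.
Proof. by exists 1; rewrite ?oner_neq0 ?scale1r. Qed.

Lemma proportional_sym v w : proportional v w -> proportional w v.
Proof.
move=> [c c0 ->]; exists c^-1; first by rewrite invr_eq0.
by rewrite scalerA mulVf // scale1r.
Qed.

Lemma proportional_trans v u w :
  proportional u v -> proportional v w -> proportional u w.
Proof.
move=> [c c0 ->] [d d0 ->]; exists (c * d); first by rewrite mulf_neq0.
by rewrite scalerA.
Qed.

Definition nzvec : Type := set_type [set v : 'cV[C]_n.+1 | v != 0].
HB.instance Definition _ := Topological.on nzvec.

Definition same_line (v w : nzvec) : bool :=
  `[< proportional (set_val v) (set_val w) >].

Lemma same_line_refl : reflexive same_line.
Proof. by move=> v; apply/asboolP; exact: proportional_refl. Qed.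

Lemma same_line_sym : symmetric same_line.
Proof. by move=> v w; apply/asboolP/asboolP; exact: proportional_sym. Qed.

Lemma same_line_trans : transitive same_line.
Proof.
by move=> v u w /asboolP uv /asboolP vw; apply/asboolP;
  exact: proportional_trans uv vw.
Qed.

Canonical same_line_equiv :=
  EquivRel same_line same_line_refl same_line_sym same_line_trans.

Definition projspace : topologicalType := quotient_topology {eq_quot same_line}.

(* Homogeneous coordinates of p, for a representative chosen once and for all;
   the notions below do not depend on this choice. *)
Definition hcoord (p : projspace) : 'cV[C]_n.+1 :=
  set_val (repr (p : {eq_quot same_line})).

Lemma hcoord_neq0 p : hcoord p != 0.
Proof. exact: (set_valP (repr (p : {eq_quot same_line}))). Qed.

Lemma hcoord_pi (v : nzvec) :
  proportional (hcoord (\pi_{eq_quot same_line} v)) (set_val v).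
Proof.
suff : same_line (repr (\pi_{eq_quot same_line} v)) v by move/asboolP.
by apply/eqmodP; rewrite reprK.
Qed.

Definition chart (i : 'I_n.+1) : set projspace := [set p | hcoord p i 0 != 0].

Definition affcoord (i j : 'I_n.+1) (p : projspace) : C :=
  hcoord p j 0 / hcoord p i 0.

Definition hyperplane (a : 'rV[C]_n.+1) : set projspace :=
  [set p | a *m hcoord p = 0].

Definition is_projective_transformation (G : projspace -> projspace) : Prop :=
  exists2 M : 'M[C]_n.+1, M \in unitmx &
    forall p, proportional (hcoord (G p)) (M *m hcoord p).

Lemma chart_pi i (v : nzvec) :
  chart i (\pi_{eq_quot same_line} v) <-> set_val v i 0 != 0.
Proof.
have [c c0 e] := hcoord_pi v.
by rewrite /chart /= e mxE mulf_eq0 (negbTE c0).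
Qed.

Lemma chart_open i : open (chart i).
Proof.
have o0 : open (~` [set (0 : C)]).
  apply/closed_openC/accessible_closed_set1/hausdorff_accessible.
  exact: norm_hausdorff.
have ov : open [set v : 'cV[C]_n.+1 | v i 0 != 0].
  have /continuousP/(_ _ o0) := @coord_continuous C n.+1 1 i 0.
  by congr (open _); apply/seteqP; split => v /= /eqP.
have on : open [set v : nzvec | set_val v i 0 != 0].
  by exists [set v : 'cV[C]_n.+1 | v i 0 != 0].
move: on; congr (open _); apply/seteqP; split => v; first by move/chart_pi.
by move=> /= ?; apply/chart_pi.
Qed.

Lemma chart_cover p : exists i, chart i p.
Proof.
apply: contrapT => /forallNP h; have /eqP[] := hcoord_neq0 p.
by apply/colP => i; rewrite mxE; apply/eqP/negPn/negP; exact: h.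
Qed.

End ProjectiveSpace.
Arguments projspace : clear implicits.

Section LineBundles.
Context {R : realType}.
Variable tau : CC R.
Local Notation C := (CC R).
Local Notation T := (torus tau).

(* A holomorphic line bundle on the torus, given by its transition functions:
   sections are families of functions with s i = lb_trans i j * s j. *)
Record line_bundle := LineBundle {
  lb_index : Type;
  lb_dom : lb_index -> set T;
  lb_trans : lb_index -> lb_index -> T -> C;
  lb_dom_open : forall i, open (lb_dom i);
  lb_dom_cover : forall u, exists i, lb_dom i u;
  lb_trans_holo : forall i j,
    holomorphic_on (lb_dom i `&` lb_dom j) (lb_trans i j);
  lb_trans_neq0 : forall i j u,
    lb_dom i u -> lb_dom j u -> lb_trans i j u != 0;
  lb_trans_cocycle : forall i j k u,
    lb_dom i u -> lb_dom j u -> lb_dom k u ->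
    lb_trans i j u * lb_trans j k u = lb_trans i k u
}.

(* F is meromorphic at z, not identically zero near z, of order k at z. The
   value of F at z itself is irrelevant. *)
Definition has_order (F : C -> C) (z : C) (k : int) : Prop :=
  exists g : C -> C, [/\ \forall w \near z, derivable g w 1, g z != 0 &
    \forall w \near z^', F w = (w - z) ^ k * g w].

Definition has_order_at (f : T -> C) (u : T) (k : int) : Prop :=
  forall z : C, \pi_T z = u -> has_order (f \o \pi_T) z k.

(* s is a nonzero meromorphic section of L with divisor D. *)
Definition section_with_divisor (L : line_bundle)
    (s : lb_index L -> T -> C) (D : T -> int) : Prop :=
  [/\ forall i j u, lb_dom i u -> lb_dom j u -> s i u = lb_trans i j u * s j u,
      forall i u, lb_dom i u -> has_order_at (s i) u (D u) &
      finite_set [set u | D u != 0]].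

Definition has_degree (L : line_bundle) (d : int) : Prop :=
  exists s D, @section_with_divisor L s D /\ \sum_(u \in [set: T]) D u = d.

End LineBundles.

Section Embeddings.
Context {R : realType} {tau : CC R} {n : nat}.
Local Notation C := (CC R).
Local Notation T := (torus tau).
Local Notation P := (projspace R n).

Definition holomorphic_map (f : T -> P) : Prop :=
  continuous f /\
  forall i j, holomorphic_on (f @^-1` chart i) (affcoord i j \o f).

Definition immersion (f : T -> P) : Prop :=
  forall z i, chart i (f (\pi_T z)) ->
  exists j, 'D_1 (affcoord i j \o f \o \pi_T) z != 0.

Definition topological_embedding (f : T -> P) : Prop :=
  [/\ continuous f, injective f &
    forall U, open U -> exists2 V, open V & f @` U = V `&` range f].

Record embedding := Embedding {
  emb_fun :> T -> P;
  emb_holomorphic : holomorphic_map emb_fun;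
  emb_immersion : immersion emb_fun;
  emb_topological : topological_embedding emb_fun
}.

Section PullbackO1.
Variable f : T -> P.
Hypothesis fh : holomorphic_map f.

Let dom (i : 'I_n.+1) : set T := f @^-1` chart i.
Let trans (i j : 'I_n.+1) (u : T) : C := affcoord i j (f u).

Lemma O1_dom_open i : open (dom i).
Proof. by have /continuousP := fh.1; apply; exact: chart_open. Qed.

Lemma O1_dom_cover u : exists i, dom i u.
Proof. exact: chart_cover. Qed.

Lemma O1_trans_holo i j : holomorphic_on (dom i `&` dom j) (trans i j).
Proof. by move=> z [zi _]; exact: fh.2. Qed.

Lemma O1_trans_neq0 i j u : dom i u -> dom j u -> trans i j u != 0.
Proof. by move=> iu ju; rewrite mulf_neq0 ?invr_eq0. Qed.

Lemma O1_trans_cocycle i j k u : dom i u -> dom j u -> dom k u ->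
  trans i j u * trans j k u = trans i k u.
Proof.
move=> iu ju _; rewrite /trans /affcoord mulrC mulrA.
by rewrite divfK.
Qed.

(* The pullback of O(1): over the preimage of [chart i], a linear form l, as a
   section of O(1), is represented by l / x_i, so that the transition function
   from j to i is x_j / x_i. *)
Definition pullback_O1 : line_bundle tau :=
  LineBundle O1_dom_open O1_dom_cover O1_trans_holo O1_trans_neq0
    O1_trans_cocycle.

End PullbackO1.

Definition embedding_has_degree (iota : embedding) (d : int) : Prop :=
  has_degree (pullback_O1 (emb_holomorphic iota)) d.

Definition in_no_hyperplane (iota : T -> P) : Prop :=
  forall a : 'rV[C]_n.+1, a != 0 -> ~ (range iota `<=` hyperplane a).

End Embeddings.
Arguments embedding {R} tau n.

(* Main.v *)
(* Lift both embeddings to C: dividing the homogeneous coordinates by a section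
   with divisor D of degree d = n + 1 and multiplying by a product of translates
   of the theta function with divisor D gives entire functions without common
   zero which are 1-periodic and satisfy F (z + tau) = c exp (- 2 pi i d z) F z.
   Composing one embedding with a translation makes the constants c agree. The
   functions of this type form a space of dimension at most d: among d + 1 of
   them some nontrivial combination vanishes at d given incongruent points, and
   its quotient by the corresponding theta product is bounded, hence constant,
   and even zero if the points are chosen so that the quotient changes sign under
   z |-> z + tau. Both families of d coordinates are free because the images span
   projective space, so an invertible matrix carries one to the other. *)
Require Import Defs.
From mathcomp Require Import all_boot all_order all_algebra complex ring lra.
From mathcomp Require Import generic_quotient ring_quotient.
From mathcomp Require Import all_classical all_reals all_analysis.
Import Order.TTheory GRing.Theory Num.Theory.
Import numFieldNormedType.Exports.

Set Implicit Arguments.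
Unset Strict Implicit.
Unset Printing Implicit Defensive.

Local Open Scope classical_set_scope.
Local Open Scope ring_scope.
Local Open Scope quotient_scope.

(** * The modulus of complex numbers *)

(** What the theta quotients need from complex analysis is Liouville's theorem, removable
    singularities and the holomorphy of an infinite product. All three come from one bound on f' at
    a point by the oscillation of f on a circle, combined with a mean value inequality. The only
    contours are squares; circles occur as images of vertical segments under exp.

    Under z |-> z + tau a product of translates of theta acquires an exponential that sees the
    divisor only through its degree, and a constant c. Translating by a multiplies c by exp (- 2 pi
    i d a), which takes every nonzero value because d = n + 1 is positive; so equal degree is
    enough, at the price of a translation.

    Sections are meromorphic and their values at zeros and poles carry no information. Identities
    between lifted functions are therefore proved on punctured neighbourhoods and extended by
    continuity. *)

Section ComplexModulus.
Context {R : realType}.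
Local Notation C := (CC R).
Implicit Types (z w : C) (x y : R).

(** The norm of [CC R] takes values in [CC R] itself; a modulus with values in [R] allows real order
    reasoning such as [lra]. *)
Definition cmod z : R := ComplexField.Normc.normc z.

Definition cpair x y : C := Complex x y.

Definition creal x : C := Complex x 0.

Definition ci : C := Complex 0 1.

Local Notation Re := complex.Re.
Local Notation Im := complex.Im.

Lemma cpairE x y : cpair x y = creal x + ci * creal y.
Proof. by rewrite /cpair /creal /ci; simpc. Qed.

Lemma cpair_ReIm z : z = cpair (Re z) (Im z). Proof. by case: z. Qed.

Lemma ReIm_eq z w : Re z = Re w -> Im z = Im w -> z = w.
Proof. by case: z w => [a b] [c d] /= -> ->. Qed.

Lemma ReD z w : Re (z + w) = Re z + Re w. Proof. by case: z w => [a b] [c d]. Qed.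
Lemma ImD z w : Im (z + w) = Im z + Im w. Proof. by case: z w => [a b] [c d]. Qed.
Lemma ReN z : Re (- z) = - Re z. Proof. by case: z => [a b]. Qed.
Lemma ImN z : Im (- z) = - Im z. Proof. by case: z => [a b]. Qed.
Lemma ReM z w : Re (z * w) = Re z * Re w - Im z * Im w.
Proof. by case: z w => [a b] [c d]. Qed.
Lemma ImM z w : Im (z * w) = Re z * Im w + Im z * Re w.
Proof. by case: z w => [a b] [c d]. Qed.
Lemma Re_creal x : Re (creal x) = x. Proof. by []. Qed.
Lemma Im_creal x : Im (creal x) = 0. Proof. by []. Qed.
Lemma Re_ci : Re ci = 0. Proof. by []. Qed.
Lemma Im_ci : Im ci = 1. Proof. by []. Qed.
Lemma Re_cpair x y : Re (cpair x y) = x. Proof. by []. Qed.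
Lemma Im_cpair x y : Im (cpair x y) = y. Proof. by []. Qed.
Lemma Re1 : Re (1 : C) = 1. Proof. by []. Qed.
Lemma Im1 : Im (1 : C) = 0. Proof. by []. Qed.
Lemma Re0 : Re (0 : C) = 0. Proof. by []. Qed.
Lemma Im0 : Im (0 : C) = 0. Proof. by []. Qed.

Definition ReImE := (ReD, ImD, ReN, ImN, ReM, ImM, Re_creal, Im_creal, Re_ci,
  Im_ci, Re_cpair, Im_cpair, Re1, Im1, Re0, Im0).

Lemma crealD x y : creal (x + y) = creal x + creal y.
Proof. by apply: ReIm_eq; rewrite !ReImE ?addr0. Qed.
Lemma crealN x : creal (- x) = - creal x.
Proof. by apply: ReIm_eq; rewrite !ReImE ?oppr0. Qed.
Lemma crealM x y : creal (x * y) = creal x * creal y.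
Proof. by apply: ReIm_eq; rewrite !ReImE; ring. Qed.
Lemma creal1 : creal 1 = 1. Proof. by []. Qed.
Lemma creal0 : creal 0 = 0. Proof. by []. Qed.
Lemma creal_nat n : creal n%:R = n%:R.
Proof. by elim: n => // n IH; rewrite !mulrSr crealD IH. Qed.
Lemma creal_eq0 x : (creal x == 0) = (x == 0).
Proof. by apply/eqP/eqP => [[]|->]. Qed.
Lemma crealV x : creal x^-1 = (creal x)^-1.
Proof.
have [->|x0] := eqVneq x 0; first by rewrite invr0 creal0 invr0.
apply: (@mulfI _ (creal x)); first by rewrite creal_eq0.
by rewrite -crealM !mulfV ?creal_eq0.
Qed.

Lemma normC_cmod z : `|z| = creal (cmod z). Proof. by []. Qed.

Lemma cmod_ge0 z : 0 <= cmod z.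
Proof. by case: z => a b; exact: sqrtr_ge0. Qed.

Lemma cmod0 : cmod 0 = 0. Proof. exact: ComplexField.Normc.normc0. Qed.

Lemma cmod1 : cmod 1 = 1. Proof. exact: ComplexField.Normc.normc1. Qed.

Lemma cmod_eq0 z : (cmod z == 0) = (z == 0).
Proof.
by apply/eqP/eqP => [/ComplexField.Normc.eq0_normc //|->]; exact: cmod0.
Qed.

Lemma cmod_gt0 z : (0 < cmod z) = (z != 0).
Proof. by rewrite lt_def cmod_eq0 cmod_ge0 andbT. Qed.

Lemma cmodM z w : cmod (z * w) = cmod z * cmod w.
Proof. exact: ComplexField.Normc.normcM. Qed.

Lemma cmodV z : cmod z^-1 = (cmod z)^-1.
Proof. exact: ComplexField.Normc.normcV. Qed.

Lemma cmodN z : cmod (- z) = cmod z.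
Proof. by case: z => a b; rewrite /cmod /= !sqrrN. Qed.

Lemma cmodD z w : cmod (z + w) <= cmod z + cmod w.
Proof.
by rewrite -lecR; have := ler_normD z w; rewrite !normC_cmod -crealD.
Qed.

Lemma cmodB z w : cmod (z - w) <= cmod z + cmod w.
Proof. by rewrite -(cmodN w); exact: cmodD. Qed.

Lemma cmod_distC z w : cmod (z - w) = cmod (w - z).
Proof. by rewrite -cmodN opprB. Qed.

Lemma cmod_creal x : cmod (creal x) = `|x|.
Proof. by rewrite /cmod /= expr0n addr0 sqrtr_sqr. Qed.

Lemma cmod_ci : cmod ci = 1.
Proof. by rewrite /cmod /= expr0n add0r expr1n sqrtr1. Qed.

Lemma cmodX z n : cmod (z ^+ n) = cmod z ^+ n.
Proof. by elim: n => [|n IH]; rewrite ?cmod1 // !exprS cmodM IH. Qed.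

Lemma Re_le_cmod z : `|Re z| <= cmod z.
Proof.
case: z => a b; rewrite /cmod /= -sqrtr_sqr ler_wsqrtr //.
by rewrite lerDl sqr_ge0.
Qed.

Lemma Im_le_cmod z : `|Im z| <= cmod z.
Proof.
case: z => a b; rewrite /cmod /= -sqrtr_sqr ler_wsqrtr //.
by rewrite lerDr sqr_ge0.
Qed.

Lemma cmod_le_ReIm z : cmod z <= `|Re z| + `|Im z|.
Proof.
rewrite {1}(cpair_ReIm z) cpairE.
by rewrite (le_trans (cmodD _ _)) // cmodM cmod_ci mul1r !cmod_creal.
Qed.

Lemma nearC z (P : C -> Prop) :
  (\forall w \near z, P w) <->
  exists2 d : R, 0 < d & forall w, cmod (w - z) < d -> P w.
Proof.
split=> [/nbhs_ballP[e /= e0 h]|[d d0 h]].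
  exists (Re e).
    by move: e0; rewrite ltcE => /andP[].
  move=> w wz; apply: h; rewrite /ball /= normC_cmod ltcE /= cmod_distC wz.
  by move: e0; rewrite ltcE /= => /andP[/eqP -> _]; rewrite eqxx.
apply/nbhs_ballP; exists (creal d); first by rewrite /= ltcR.
move=> w; rewrite /ball /= normC_cmod ltcR => wz.
by apply: h; rewrite cmod_distC.
Qed.

Lemma dnearC z (P : C -> Prop) :
  (\forall w \near z^', P w) <->
  exists2 d : R, 0 < d & forall w, cmod (w - z) < d -> w != z -> P w.
Proof.
rewrite near_withinE; split=> [/nearC[d d0 h]|[d d0 h]].
  by exists d => // w wz wn; apply: h.
by apply/nearC; exists d => // w wz wn; apply: h.
Qed.

Lemma cvgC {T : Type} (F : set_system T) (FF : Filter F) (f : T -> C) z :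
  f @ F --> z <-> forall e : R, 0 < e -> \forall t \near F, cmod (f t - z) < e.
Proof.
split=> [/cvgrPdist_lt h e e0|h].
  have := h (creal e); rewrite ltcR => /(_ e0).
  by apply: filterS => t; rewrite normC_cmod ltcR cmod_distC.
apply/cvgrPdist_lt => e e0.
have [e1 e2] : 0 < Re e /\ e = creal (Re e).
  by move: e0; rewrite ltcE /= => /andP[/eqP h0 ->]; split => //; apply: ReIm_eq.
have := h _ e1; apply: filterS => t; rewrite normC_cmod e2 ltcR cmod_distC.
by [].
Qed.

Lemma continuousC (f : C -> C) z :
  {for z, continuous f} <-> forall e : R, 0 < e ->
  exists2 d : R, 0 < d & forall w, cmod (w - z) < d -> cmod (f w - f z) < e.
Proof.
split=> [/(@cvgC _ (nbhs z) _ _ _) h e e0|h]; first by have /nearC := h _ e0.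
by apply/(@cvgC _ (nbhs z)) => e e0; apply/nearC; exact: h.
Qed.

End ComplexModulus.

(** * Complex derivatives, completeness and bisection of squares *)

(** Nothing is divided by [y - x] in this form, so [y = x] is no exception and error terms can
    simply be added. *)
Lemma is_derive_near (K : numFieldType) (f : K -> K) (x L : K) :
  is_derive x 1 f L <-> forall e : K, 0 < e ->
    \forall y \near x, `|f y - f x - L * (y - x)| <= e * `|y - x|.
Proof.
have E L' h : h != 0 -> h^-1 *: ((f \o shift x) (h *: 1) - f x) - L' =
    (f (h + x) - f x - L' * h) / h.
  move=> h0; rewrite /= [h *: 1]mulr1 [_ *: _]mulrC [RHS]mulrBl.
  by rewrite (mulfK h0).
split=> [[df <-] e e0|h].
  have cv : (fun h => h^-1 *: ((f \o shift x) (h *: 1) - f x)) @ 0^' --> 'D_1 f x.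
    exact: df.
  move/cvgrPdist_le/(_ _ e0) : cv; rewrite near_withinE => /nbhs_ballP[d /= d0 hd].
  apply/nbhs_ballP; exists d => // y; rewrite /ball /= distrC => yx.
  have [->|ynx] := eqVneq y x; first by rewrite !subrr mulr0 subr0 normr0 mulr0.
  have yx0 : y - x != 0 by rewrite subr_eq0.
  have := hd (y - x); rewrite /ball /= sub0r normrN => /(_ yx yx0).
  rewrite distrC (E _ _ yx0) subrK normrM normfV.
  by rewrite ler_pdivrMr ?normr_gt0.
have cv : (fun h => h^-1 *: ((f \o shift x) (h *: 1) - f x)) @ 0^' --> L.
  apply/cvgrPdist_le => e e0; rewrite near_withinE; apply/nbhs_ballP.
  have /nbhs_ballP[d /= d0 hd] := h _ e0.
  exists d => // k; rewrite /ball /= sub0r normrN => kd k0.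
  rewrite distrC (E _ _ k0) normrM normfV ler_pdivrMr ?normr_gt0 //.
  have := hd (k + x); rewrite /ball /= addrK; apply.
  by rewrite opprD addrCA subrr addr0 normrN.
by split; [apply/cvg_ex; exists L | exact/cvg_lim].
Qed.

Section Preliminaries.
Context {R : realType}.
Local Notation C := (CC R).
Local Notation Re := complex.Re.
Local Notation Im := complex.Im.

Lemma is_deriveC (f : C -> C) (z L : C) :
  is_derive z 1 f L <-> forall e : R, 0 < e -> exists2 d : R, 0 < d &
    forall w, cmod (w - z) < d ->
      cmod (f w - f z - L * (w - z)) <= e * cmod (w - z).
Proof.
split=> [/is_derive_near h e e0|h].
  have := h (creal e); rewrite ltcR => /(_ e0)/nearC[d d0 hd].
  by exists d => // w /hd; rewrite !normC_cmod -crealM lecR.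
apply/is_derive_near => e e0.
have [e1 ->] : 0 < Re e /\ e = creal (Re e).
  by move: e0; rewrite ltcE => /andP[/eqP h0 ->]; split => //; apply: ReIm_eq.
have [d d0 hd] := h _ e1; apply/nearC; exists d => // w /hd.
by rewrite !normC_cmod -crealM lecR.
Qed.

Lemma is_deriveR (f : R -> R) (x L : R) :
  is_derive x 1 f L <-> forall e : R, 0 < e -> exists2 d : R, 0 < d &
    forall y, `|y - x| < d -> `|f y - f x - L * (y - x)| <= e * `|y - x|.
Proof.
rewrite is_derive_near; split=> [h e /h/nbhs_ballP[d /= d0 hd]|h e /h[d d0 hd]].
  by exists d => // y yx; apply: hd; rewrite /ball /= distrC.
by apply/nbhs_ballP; exists d => // y; rewrite /ball /= distrC; exact: hd.
Qed.

Lemma complete_cmod (a : nat -> C) :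
  (forall e : R, 0 < e -> exists N, forall m n, (N <= m)%N -> (N <= n)%N ->
     cmod (a m - a n) <= e) ->
  exists l, forall e : R, 0 < e -> exists N, forall n, (N <= n)%N ->
     cmod (a n - l) <= e.
Proof.
move=> h.
have H (p : C -> R) : (forall z w, p (z - w) = p z - p w) ->
    (forall z, `|p z| <= cmod z) ->
    exists l, forall e : R, 0 < e -> exists N, forall n, (N <= n)%N ->
     `|p (a n) - l| <= e.
  move=> pB ple.
  have cvp : cvgn (p \o a).
    apply/cauchy_cvgP/cauchy_exP => e e0; have e20 : 0 < e / 2 by lra.
    have [N hN] := h _ e20.
    exists (p (a N)), N => // n /= Nn; rewrite /ball /= -pB.
    apply: le_lt_trans (ple _) _; apply: le_lt_trans (hN _ _ (leqnn N) Nn) _; lra.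
  exists (limn (p \o a)) => e e0.
  have /cvgrPdist_le /(_ _ e0)[N _ hN] := cvp.
  by exists N => n Nn; rewrite distrC; exact: hN.
have [x hx] := H (@complex.Re R) (fun z w => ltac:(by rewrite ReD ReN)) Re_le_cmod.
have [y hy] := H (@complex.Im R) (fun z w => ltac:(by rewrite ImD ImN)) Im_le_cmod.
exists (cpair x y) => e e0; have e20 : 0 < e / 2 by lra.
have [N hN] := hx _ e20; have [M hM] := hy _ e20.
exists (maxn N M) => n; rewrite geq_max => /andP[Nn Mn].
apply: le_trans (cmod_le_ReIm _) _; rewrite !ReImE /=.
have := hN _ Nn; have := hM _ Mn; lra.
Qed.

Definition in_square (a : C) (s : R) (z : C) :=
  Re a <= Re z <= Re a + s /\ Im a <= Im z <= Im a + s.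

Lemma in_square_dist a s z w : in_square a s z -> in_square a s w ->
  cmod (w - z) <= 2 * s.
Proof.
move=> [z1 z2] [w1 w2]; apply: le_trans (cmod_le_ReIm _) _; rewrite !ReImE.
have : `|Re w - Re z| <= s by rewrite ler_norml; lra.
have : `|Im w - Im z| <= s by rewrite ler_norml; lra.
lra.
Qed.

(* Bisection: the negation of the conclusion propagates to a sequence of nested
   squares, which contradicts the local hypothesis at their common point. *)
Lemma square_ind (P : C -> R -> Prop) :
  (forall a s, 0 < s -> P a s -> P (a + creal s) s -> P (a + ci * creal s) s ->
     P (a + creal s + ci * creal s) s -> P a (s + s)) ->
  (forall z, exists2 d : R, 0 < d &
     forall a s, 0 < s -> s < d -> in_square a s z -> P a s) ->
  forall a s, 0 < s -> P a s.
Proof.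
move=> Psplit Ploc a0 s0 s00; apply: contrapT => nP.
have step (a : C) s : 0 < s -> ~ P a s -> exists b, [/\ ~ P b (s / 2),
    Re a <= Re b <= Re a + s / 2 & Im a <= Im b <= Im a + s / 2].
  move=> spos nPa; apply: contrapT => hb; apply: nPa.
  have -> : s = s / 2 + s / 2 by lra.
  by apply: Psplit; [lra | apply: contrapT => nPb; apply: hb;
    eexists; split; [exact: nPb | |]; rewrite ?ReImE; lra ..].
have /choice[nx hnx] : forall p : C * R, exists b, 0 < p.2 -> ~ P p.1 p.2 ->
   [/\ ~ P b (p.2 / 2),
    Re p.1 <= Re b <= Re p.1 + p.2 / 2 & Im p.1 <= Im b <= Im p.1 + p.2 / 2].
  move=> [a s] /=; case: (pselect (0 < s /\ ~ P a s)) => [[h1 h2]|h].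
    by have [b hb] := step _ _ h1 h2; exists b.
  by exists 0 => h1 h2; case: h.
pose q := fix q n := if n is m.+1 then (nx (q m), (q m).2 / 2) else (a0, s0).
have qE n : (q n).2 = s0 / 2 ^+ n.
  elim: n => [|n IH]; first by rewrite /= divr1.
  by rewrite /= IH exprSr invfM mulrA.
have q2 n : 0 < (q n).2 by rewrite qE divr_gt0 // exprn_gt0.
have qP n : ~ P (q n).1 (q n).2.
  by elim: n => [//|n IH]; have [] := hnx _ (q2 n) IH.
have qRe n m : Re (q n).1 <= Re (q (n + m)%N).1 /\
    Re (q (n + m)%N).1 + (q (n + m)%N).2 <= Re (q n).1 + (q n).2.
  elim: m => [|m [IH1 IH2]]; first by rewrite addn0.
  rewrite addnS; have [_ + _] := hnx _ (q2 (n + m)%N) (qP _).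
  by rewrite /=; have := q2 (n + m)%N; lra.
have qIm n m : Im (q n).1 <= Im (q (n + m)%N).1 /\
    Im (q (n + m)%N).1 + (q (n + m)%N).2 <= Im (q n).1 + (q n).2.
  elim: m => [|m [IH1 IH2]]; first by rewrite addn0.
  rewrite addnS; have [_ _] := hnx _ (q2 (n + m)%N) (qP _).
  by rewrite /=; have := q2 (n + m)%N; lra.
(* The supremum of the left ends lies in all the nested intervals; this is used once for real and
   once for imaginary parts. *)
have nested (u : nat -> R) (v : nat -> R) : (forall n, 0 < v n) ->
    (forall n m, u n <= u (n + m)%N /\ u (n + m)%N + v (n + m)%N <= u n + v n) ->
    exists x, forall n, u n <= x <= u n + v n.
  move=> v0 uv.
  have hle n m : u m <= u n + v n.
    have [nm|mn] := leqP n m.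
      by rewrite -(subnKC nm); have := uv n (m - n)%N; have := v0 (n + (m - n))%N; lra.
    have := uv m (n - m)%N; rewrite subnKC; last exact: ltnW.
    by have := v0 n; lra.
  have hs : has_sup (range u).
    by split; [exists (u 0%N), 0%N | exists (u 0%N + v 0%N) => _ [m _ <-]].
  exists (sup (range u)) => n; apply/andP; split.
    by apply: sup_upper_bound => //; exists n.
  by apply: ge_sup; [exact: hs.1 | move=> _ [m _ <-]].
have [x hx] := nested _ _ q2 qRe.
have [y hy] := nested _ _ q2 qIm.
have [d d0 hd] := Ploc (cpair x y).
have [n hn] : exists n, (q n).2 < d.
  have h2 : `|2^-1 : R| < 1 by rewrite ger0_norm; lra.
  have /cvgrPdist_lt/(_ _ d0)[n _ /(_ n (leqnn n))] := cvg_geometric s0 h2.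
  rewrite /= sub0r normrN => h; exists n.
  rewrite qE -exprVn; apply: le_lt_trans (ler_norm _) h.
by apply: (qP n); apply: hd.
Qed.

End Preliminaries.

(** * Goursat's theorem *)

Section Goursat.
Context {R : realType}.
Local Notation C := (CC R).
Local Notation Re := complex.Re.
Local Notation Im := complex.Im.
Local Notation mu := (@lebesgue_measure R).

Definition rint (u : R -> R) (a b : R) : R := (\int[mu]_(t in `[a, b]) u t)%R.

Lemma continuous_integrable (u : R -> R) a b :
  continuous u -> mu.-integrable `[a, b] (EFin \o u).
Proof.
move=> cu; apply: continuous_compact_integrable; first exact: segment_compact.
exact: continuous_subspaceT.
Qed.

Lemma rintD (u : R -> R) a c b : continuous u -> a <= c -> c <= b ->
  rint u a b = rint u a c + rint u c b.
Proof.
move=> cu ac cb; have iu x y := @continuous_integrable u x y cu.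
have := @Rintegral_itvB R u (BLeft a) (BRight b) c (iu a b).
rewrite !bnd_simp => /(_ ac cb)/eqP; rewrite subr_eq => /eqP.
rewrite /rint => ->; rewrite addrC; congr (_ + _).
apply: Rintegral_itv_obnd_cbnd; apply: integrableS (iu c b) => //.
by apply: subset_itvr; rewrite bnd_simp.
Qed.

Lemma rint_poly (p q : R) a b : a <= b ->
  rint (fun t => p + q * t) a b = p * (b - a) + q * ((b ^+ 2 - a ^+ 2) / 2).
Proof.
rewrite le_eqVlt => /predU1P[<-|ab].
  by rewrite /rint set_itv1 Rintegral_set1; ring.
pose F := p *: (id : R -> R) + (q / 2) *: ((id : R -> R) * id).
have FE t : F t = p * t + q / 2 * (t * t) by [].
have dF (t : R) : is_derive t 1 F (p + q * t).
  have -> : p + q * t = p *: 1 + (q / 2) *: (t *: 1 + t *: 1).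
    by rewrite ![_ *: _]mulr1 [in RHS]/GRing.scale /=; field.
  exact: (is_deriveD (is_deriveZ p (is_derive_id t 1))
    (is_deriveZ (q / 2) (is_deriveM (is_derive_id t 1) (is_derive_id t 1)))).
rewrite /rint /Rintegral (@continuous_FTC2 R _ F) //.
- by rewrite /= !FE; field.
- apply: continuous_subspaceT => t.
  have : derivable (fun t => p + q * t) t 1 by [].
  by move/derivable1_diffP/differentiable_continuous.
- have cF t : {for t, continuous F}.
    by apply/differentiable_continuous/derivable1_diffP; have [] := dF t.
  split=> [t _||]; first by have [] := dF t.
  + by apply: cvg_at_right_filter; exact: cF.
  + by apply: cvg_at_left_filter; exact: cF.
- by move=> t _; rewrite derive1E; have [_ ->] := dF t.
Qed.

(** Monotonicity of the integral suffices: [u] lies between the affine function lowered by [e] and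
    raised by [e]. *)
Lemma rint_affine (u : R -> R) (p q e a b : R) : continuous u -> a <= b ->
  (forall t, a <= t <= b -> `|u t - (p + q * t)| <= e) ->
  `|rint u a b - (p * (b - a) + q * ((b ^+ 2 - a ^+ 2) / 2))| <= e * (b - a).
Proof.
move=> cu ab h.
have cp r : continuous (fun t => r + q * t).
  move=> t; have : derivable (fun t => r + q * t) t 1 by [].
  by move/derivable1_diffP/differentiable_continuous.
have mab : measurable (`[a, b] : set (measurableTypeR R)) by [].
have L1 : rint u a b <= rint (fun t => (p + e) + q * t) a b.
  apply: le_Rintegral => //; [exact: continuous_integrable..|].
  move=> t; rewrite /= in_itv /= => /h; rewrite ler_norml; lra.
have L2 : rint (fun t => (p - e) + q * t) a b <= rint u a b.
  apply: le_Rintegral => //; [exact: continuous_integrable..|].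
  move=> t; rewrite /= in_itv /= => /h; rewrite ler_norml; lra.
by move: L1 L2; rewrite !rint_poly // ler_norml; lra.
Qed.

Definition ccont (u : R -> C) :=
  continuous (fun t => Re (u t)) /\ continuous (fun t => Im (u t)).

Definition cint (u : R -> C) (a b : R) : C :=
  cpair (rint (fun t => Re (u t)) a b) (rint (fun t => Im (u t)) a b).

Lemma ccont_comp (g : C -> C) (gam : R -> C) (K : R) :
  continuous g -> 0 < K -> (forall s t, cmod (gam s - gam t) <= K * `|s - t|) ->
  ccont (fun t => g (gam t)).
Proof.
move=> cg K0 hK.
have H t (e : R) : 0 < e -> \forall s \near t, cmod (g (gam t) - g (gam s)) < e.
  move=> e0; have [d d0 hd] := (continuousC _ _).1 (cg (gam t)) _ e0.
  apply/nbhs_ballP; exists (d / K); rewrite /= ?divr_gt0 // => s.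
  rewrite /ball /= distrC => st; rewrite cmod_distC; apply: hd.
  by apply: le_lt_trans (hK _ _) _; rewrite mulrC -ltr_pdivlMr.
split=> t; apply/cvgrPdist_lt => e e0; have := H t e e0; apply: filterS => s.
  by apply: le_lt_trans; rewrite -ReN -ReD; exact: Re_le_cmod.
by apply: le_lt_trans; rewrite -ImN -ImD; exact: Im_le_cmod.
Qed.

Lemma cintD (u : R -> C) a c b : ccont u -> a <= c -> c <= b ->
  cint u a b = cint u a c + cint u c b.
Proof.
move=> [cr ci] ac cb.
by apply: ReIm_eq; rewrite ReImE /=; exact: rintD.
Qed.

(* The factor 2 comes from estimating real and imaginary parts separately; the
   constants of the later estimates inherit it and are not optimal. *)
Lemma cint_affine (u : R -> C) (p q : C) (e a b : R) : ccont u -> a <= b ->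
  (forall t, a <= t <= b -> cmod (u t - (p + q * creal t)) <= e) ->
  cmod (cint u a b - (p * creal (b - a) + q * creal ((b ^+ 2 - a ^+ 2) / 2)))
    <= 2 * (e * (b - a)).
Proof.
move=> [cr ci] ab h; apply: le_trans (cmod_le_ReIm _) _.
have -> : 2 * (e * (b - a)) = e * (b - a) + e * (b - a) by ring.
rewrite !ReImE !mulr0 !subr0 !add0r; apply: lerD.
  apply: rint_affine => // t /h; apply: le_trans.
  have := Re_le_cmod (u t - (p + q * creal t)).
  by rewrite !ReImE mulr0 subr0.
apply: rint_affine => // t /h; apply: le_trans.
have := Im_le_cmod (u t - (p + q * creal t)).
by rewrite !ReImE mulr0 add0r.
Qed.

Lemma cmod_vert x s t : cmod (cpair x s - cpair x t : C) = `|s - t|.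
Proof.
have -> : cpair x s - cpair x t = ci * creal (s - t) :> C.
  by apply: ReIm_eq; rewrite !ReImE /=; ring.
by rewrite cmodM cmod_ci mul1r cmod_creal.
Qed.

Lemma cmod_horiz y s t : cmod (cpair s y - cpair t y : C) = `|s - t|.
Proof.
have -> : cpair s y - cpair t y = creal (s - t) :> C.
  by apply: ReIm_eq; rewrite !ReImE /=; ring.
by rewrite cmod_creal.
Qed.

Lemma derivable_continuousC (g : C -> C) z :
  derivable g z 1 -> {for z, continuous g}.
Proof. by move/derivable1_diffP/differentiable_continuous. Qed.

Section Square.
Variable g : C -> C.
Hypothesis dg : forall z, derivable g z 1.

Definition vint x c s : C := cint (fun t => g (cpair x t)) c (c + s).
Definition hint y a s : C := cint (fun t => g (cpair t y)) a (a + s).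

(* The integral of [g] along the boundary of the square, counterclockwise. *)
Definition square_int (a : C) (s : R) : C :=
  ci * (vint (Re a + s) (Im a) s - vint (Re a) (Im a) s)
  - (hint (Im a + s) (Re a) s - hint (Im a) (Re a) s).

Let cg : continuous g. Proof. by move=> z; exact: derivable_continuousC. Qed.

Let vcont x : ccont (fun t => g (cpair x t)).
Proof. by apply: (ccont_comp cg ltr01) => s t; rewrite cmod_vert mul1r. Qed.

Let hcont y : ccont (fun t => g (cpair t y)).
Proof. by apply: (ccont_comp cg ltr01) => s t; rewrite cmod_horiz mul1r. Qed.

(** Each inner edge of the four quarters is traversed twice, in opposite directions. *)
Lemma square_int_split a s : 0 < s ->
  square_int a (s + s) = square_int a s + square_int (a + creal s) s
    + square_int (a + ci * creal s) s + square_int (a + creal s + ci * creal s) s.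
Proof.
move=> s0.
have V x c : vint x c (s + s) = vint x c s + vint x (c + s) s.
  rewrite /vint addrA; apply: cintD; [exact: vcont|lra|lra].
have H y c : hint y c (s + s) = hint y c s + hint y (c + s) s.
  rewrite /hint addrA; apply: cintD; [exact: hcont|lra|lra].
rewrite /square_int !ReImE !V !H !mul0r !mulr0 !subr0 !addr0 !mul1r !add0r !addrA.
ring.
Qed.

(** Near [z] the function is affine up to an error small against the distance to [z], and an affine
    function has boundary integral zero. *)
Lemma square_int_local z (e : R) : 0 < e -> exists2 d : R, 0 < d &
  forall a s, 0 < s -> s < d -> in_square a s z ->
    cmod (square_int a s) <= e * s ^+ 2.
Proof.
move=> e0; have /derivableP := @dg z.
set L := 'D_1 g z => /is_deriveC h.
(* On a side of length s the error is at most e / 16 * 2s, so [cint_affine] yields e / 4 * s ^ 2 per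
   side, and there are four sides. *)
have e16 : 0 < e / 16 by lra.
have [d d0 hd] := h _ e16.
exists (d / 2); first by lra.
move=> a s s0 sd az.
have aff w : in_square a s w ->
    cmod (g w - (g z + L * (w - z))) <= e / 16 * (2 * s).
  move=> aw; have wz := in_square_dist az aw.
  rewrite opprD addrA; apply: le_trans (hd _ _) _; first by lra.
  by apply: ler_wpM2l => //; lra.
pose V x := (g z + L * (creal x - z)) * creal s
  + L * ci * creal (((Im a + s) ^+ 2 - Im a ^+ 2) / 2).
pose H y := (g z + L * (ci * creal y - z)) * creal s
  + L * creal (((Re a + s) ^+ 2 - Re a ^+ 2) / 2).
have bV x : Re a <= x <= Re a + s ->
    cmod (vint x (Im a) s - V x) <= e / 4 * s ^+ 2.
  move=> hx.
  have -> : e / 4 * s ^+ 2 = 2 * (e / 16 * (2 * s) * (Im a + s - Im a)) by field.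
  rewrite /V {2}(_ : s = Im a + s - Im a); last by ring.
  apply: cint_affine; [exact: vcont|lra|] => t ht.
  have := aff (cpair x t) (conj hx ht).
  by rewrite cpairE; congr (cmod _ <= _); ring.
have bH y : Im a <= y <= Im a + s ->
    cmod (hint y (Re a) s - H y) <= e / 4 * s ^+ 2.
  move=> hy.
  have -> : e / 4 * s ^+ 2 = 2 * (e / 16 * (2 * s) * (Re a + s - Re a)) by field.
  rewrite /H {2}(_ : s = Re a + s - Re a); last by ring.
  apply: cint_affine; [exact: hcont|lra|] => t ht.
  have := aff (cpair t y) (conj ht hy).
  by rewrite cpairE; congr (cmod _ <= _); ring.
(* [V] and [H] are the exact integrals of the affine part along the sides; their signed sum is zero,
   which is what [ring] checks here. *)
have -> : square_int a s =
    (ci * (vint (Re a + s) (Im a) s - V (Re a + s))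
      - ci * (vint (Re a) (Im a) s - V (Re a)))
    - ((hint (Im a + s) (Re a) s - H (Im a + s))
      - (hint (Im a) (Re a) s - H (Im a))).
  rewrite /square_int /V /H !crealD; ring.
have -> : e * s ^+ 2 = (e / 4 * s ^+ 2 + e / 4 * s ^+ 2)
   + (e / 4 * s ^+ 2 + e / 4 * s ^+ 2) by field.
apply: le_trans (cmodB _ _) _; apply: lerD.
  apply: le_trans (cmodB _ _) _; rewrite !cmodM cmod_ci !mul1r.
  by apply: lerD; apply: bV; lra.
by apply: le_trans (cmodB _ _) _; apply: lerD; apply: bH; lra.
Qed.

(** The bound e * s ^ 2 is a multiple of the area, so it adds up exactly when four squares are
    assembled; bisection then carries it from small squares to all squares, for every e. *)
Lemma goursat a s : 0 < s -> square_int a s = 0.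
Proof.
move=> s0; apply/eqP; rewrite -cmod_eq0 eq_le cmod_ge0 andbT.
have H e : 0 < e -> cmod (square_int a s) <= e * s ^+ 2.
  move=> e0; move: a s s0.
  apply: (square_ind (P := fun a s => cmod (square_int a s) <= e * s ^+ 2)).
    move=> a s s0 h1 h2 h3 h4; rewrite square_int_split //.
    have -> : e * (s + s) ^+ 2 =
      e * s ^+ 2 + e * s ^+ 2 + e * s ^+ 2 + e * s ^+ 2 by ring.
    by do 3!(apply: le_trans (cmodD _ _) _; apply: lerD => //).
  by move=> z; exact: square_int_local.
apply/ler_addgt0Pl => e e0; rewrite addr0.
have := H (e / s ^+ 2); rewrite divfK ?gt_eqF ?exprn_gt0 //.
by apply; rewrite divr_gt0 ?exprn_gt0.
Qed.

(** The two horizontal sides cancel by periodicity. As only squares are integrated, the abscissa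
    moves by exactly the length of the period. *)
Lemma vint_periodic x s : 0 < s -> (forall z, g (z + ci * creal s) = g z) ->
  vint (x + s) 0 s = vint x 0 s.
Proof.
move=> s0 per; have := goursat (creal x) s0.
rewrite /square_int !ReImE add0r.
have -> : hint s x s = hint 0 x s.
  rewrite /hint; congr (cint _ _ _); apply/funext => t.
  by rewrite -(per (cpair t 0)); congr g; apply: ReIm_eq; rewrite !ReImE /=; ring.
rewrite subrr subr0 => /eqP; rewrite mulf_eq0 subr_eq0 -cmod_eq0 cmod_ci.
by rewrite oner_eq0 => /eqP.
Qed.

End Square.

End Goursat.

(** * The complex exponential *)

Section Exponential.
Context {R : realType}.
Local Notation C := (CC R).
Local Notation Re := complex.Re.
Local Notation Im := complex.Im.

Definition cexp (z : C) : C :=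
  cpair (expR (Re z) * cos (Im z)) (expR (Re z) * sin (Im z)).

Lemma Re_cexp z : Re (cexp z) = expR (Re z) * cos (Im z). Proof. by []. Qed.
Lemma Im_cexp z : Im (cexp z) = expR (Re z) * sin (Im z). Proof. by []. Qed.
Definition cexpE := (Re_cexp, Im_cexp).

Lemma cexpD z w : cexp (z + w) = cexp z * cexp w.
Proof.
by apply: ReIm_eq; rewrite !(cexpE, ReImE) expRD ?cosD ?sinD; ring.
Qed.

Lemma cexp0 : cexp 0 = 1.
Proof. by apply: ReIm_eq; rewrite !(cexpE, ReImE) expR0 ?cos0 ?sin0; ring. Qed.

Lemma cexpN z : cexp (- z) * cexp z = 1.
Proof. by rewrite -cexpD addNr cexp0. Qed.

Lemma cexp_neq0 z : cexp z != 0.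
Proof.
apply/eqP => h; have /eqP := cexpN z.
by rewrite h mulr0 eq_sym oner_eq0.
Qed.

Lemma cexpNV z : cexp (- z) = (cexp z)^-1.
Proof. by apply: (mulIf (cexp_neq0 z)); rewrite cexpN mulVf ?cexp_neq0. Qed.

Lemma cmod_cexp z : cmod (cexp z) = expR (Re z).
Proof.
rewrite /cmod /= !exprMn -mulrDr cos2Dsin2 mulr1 sqrtr_sqr.
by rewrite ger0_norm ?expR_ge0.
Qed.

Lemma cexp_nat z n : cexp (z * n%:R) = cexp z ^+ n.
Proof.
elim: n => [|n IH]; first by rewrite mulr0 cexp0 expr0.
by rewrite mulrSr mulrDr mulr1 cexpD IH exprSr.
Qed.

Lemma cexp_2pi : cexp (ci * creal (pi *+ 2)) = 1.
Proof.
apply: ReIm_eq; rewrite !(cexpE, ReImE, mul0r, mul1r, subr0, add0r).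
  by rewrite expR0 cos2pi mulr1.
by rewrite expR0 sin2pi mulr0.
Qed.

Lemma cexp_periodic z : cexp (z + ci * creal (pi *+ 2)) = cexp z.
Proof. by rewrite cexpD cexp_2pi mulr1. Qed.

Lemma cexp_small (e : R) : 0 < e -> exists2 d : R, 0 < d &
  forall h : C, cmod h < d -> cmod (cexp h - 1 - h) <= e * cmod h.
Proof.
(* The errors add up to seven times [e1 * r]: 1 + 2 from the real part ([T1], [T3]) and 1 + 2 + 1
   from the imaginary part ([T2], [T4], [T5]). The bound 1 on [r] serves [x2], the bound [e1] serves
   [T5]. *)
move=> e0; pose e1 := e / 7; have e10 : 0 < e1 by rewrite /e1; lra.
have [d1 d10 H1] := (is_deriveR _ _ _).1 (is_derive_expR (0 : R)) _ e10.
have [d2 d20 H2] := (is_deriveR _ _ _).1 (is_derive_sin (0 : R)) _ e10.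
have [d3 d30 H3] := (is_deriveR _ _ _).1 (is_derive_cos (0 : R)) _ e10.
pose d := Num.min (Num.min d1 d2) (Num.min d3 (Num.min 1 e1)).
exists d; first by rewrite /d !lt_min d10 d20 d30 e10 ltr01.
move=> h; rewrite /d !lt_min => /andP[/andP[hd1 hd2] /and3P[hd3 h1 he]].
have := Re_le_cmod h; have := Im_le_cmod h; move: (cmod h) hd1 hd2 hd3 h1 he.
move=> r rd1 rd2 rd3 r1 re hy hx.
apply: le_trans (cmod_le_ReIm _) _; rewrite !ReImE subr0 /=.
set x := Re h in hx *; set y := Im h in hy *.
have := H1 x; rewrite subr0 expR0 mul1r => /(_ (le_lt_trans hx rd1)) B1.
have := H2 y; rewrite subr0 sin0 cos0 mul1r subr0 => /(_ (le_lt_trans hy rd2)) B2.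
have := H3 y; rewrite subr0 sin0 cos0 oppr0 mul0r subr0 => /(_ (le_lt_trans hy rd3)) B3.
have r0 : 0 <= r by apply: le_trans hx.
have e2pi : `|expR x - 1 - x| <= e1 * r by apply: le_trans B1 _; rewrite ler_pM2l.
have sy : `|sin y - y| <= e1 * r by apply: le_trans B2 _; rewrite ler_pM2l.
have cy : `|cos y - 1| <= e1 * r by apply: le_trans B3 _; rewrite ler_pM2l.
have x2 : `|1 + x| <= 2.
  by apply: le_trans (ler_normD _ _) _; rewrite normr1; lra.
have -> : expR x * cos y - 1 - x = (expR x - 1 - x) * cos y + (1 + x) * (cos y - 1).
  by ring.
have -> : expR x * sin y - y =
  (expR x - 1 - x) * sin y + (1 + x) * (sin y - y) + x * y by ring.
have T1 : `|(expR x - 1 - x) * cos y| <= e1 * r.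
  rewrite normrM -[leRHS]mulr1; apply: ler_pM => //; exact: cos_max.
have T2 : `|(expR x - 1 - x) * sin y| <= e1 * r.
  rewrite normrM -[leRHS]mulr1; apply: ler_pM => //; exact: sin_max.
have T3 : `|(1 + x) * (cos y - 1)| <= 2 * (e1 * r).
  by rewrite normrM; apply: ler_pM.
have T4 : `|(1 + x) * (sin y - y)| <= 2 * (e1 * r).
  by rewrite normrM; apply: ler_pM.
have T5 : `|x * y| <= e1 * r.
  rewrite normrM; apply: ler_pM => //; lra.
have := ler_normD ((expR x - 1 - x) * cos y) ((1 + x) * (cos y - 1)).
have := ler_normD ((expR x - 1 - x) * sin y + (1 + x) * (sin y - y)) (x * y).
have := ler_normD ((expR x - 1 - x) * sin y) ((1 + x) * (sin y - y)).
have -> : e * r = 7 * (e1 * r) by rewrite /e1; field.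
lra.
Qed.

Lemma is_derive_cexp (z : C) : is_derive z 1 cexp (cexp z).
Proof.
apply/is_deriveC => e e0.
have k0 : 0 < cmod (cexp z) by rewrite cmod_gt0 cexp_neq0.
have [d d0 hd] := cexp_small (divr_gt0 e0 k0).
exists d => // w /hd h.
have -> : cexp w - cexp z - cexp z * (w - z) = cexp z * (cexp (w - z) - 1 - (w - z)).
  rewrite -{1}(subrK z w) cexpD; ring.
by rewrite cmodM -ler_pdivlMl // mulrC mulrAC.
Qed.

Lemma cexp_surj w : w != 0 -> exists z, cexp z = w.
Proof.
move=> w0; have r0 : 0 < cmod w by rewrite cmod_gt0.
suff [y hy] : exists y, creal (cmod w) * cpair (cos y) (sin y) = w.
  exists (cpair (ln (cmod w)) y); rewrite -[RHS]hy.
  by apply: ReIm_eq; rewrite !(cexpE, ReImE) lnK // ?mul0r ?subr0 ?addr0.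
have [u wu] : exists u, w = creal (cmod w) * u.
  exists (w / creal (cmod w)); rewrite mulrC divfK //.
  by rewrite creal_eq0 gt_eqF.
have u1 : Re u ^+ 2 + Im u ^+ 2 = 1.
  have /eqP : cmod w = cmod w * cmod u.
    by rewrite {1}wu cmodM cmod_creal ger0_norm // ltW.
  rewrite -{1}[cmod w]mulr1 (inj_eq (mulfI (lt0r_neq0 r0))) => /eqP.
  case: (u) => a b; rewrite /cmod /= => h.
  have := congr1 (fun x => x ^+ 2) h; rewrite /= expr1n sqr_sqrtr //.
  by rewrite addr_ge0 ?sqr_ge0.
have c1 : -1 <= Re u <= 1.
  have : Re u ^+ 2 <= 1 by rewrite -u1 lerDl sqr_ge0.
  by move=> h; apply/andP; split; nra.
have sa : Num.sqrt (1 - Re u ^+ 2) = `|Im u|.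
  by rewrite -u1 addrAC subrr add0r sqrtr_sqr.
(* [acos] reaches only the upper half of the unit circle; the lower half comes from the opposite
   angle. *)
have [i0|i0] := leP 0 (Im u).
  exists (acos (Re u)); rewrite [RHS]wu; congr (_ * _).
  apply: ReIm_eq; rewrite /=; first by rewrite acosK.
  by rewrite sin_acos // sa ger0_norm.
exists (- acos (Re u)); rewrite [RHS]wu; congr (_ * _).
apply: ReIm_eq; rewrite /=; first by rewrite cosN acosK.
by rewrite sinN sin_acos // sa ltr0_norm // opprK.
Qed.

Lemma cexp_2pi_int (k : int) : cexp (ci * creal (pi *+ 2) * k%:~R) = 1.
Proof.
case: k => n; first by rewrite -pmulrn cexp_nat cexp_2pi expr1n.
by rewrite NegzE mulrNz mulrN cexpNV -pmulrn cexp_nat cexp_2pi expr1n invr1.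
Qed.

Lemma creal_int (k : int) : creal k%:~R = k%:~R :> C.
Proof.
case: k => n; first by rewrite -!pmulrn creal_nat.
by rewrite NegzE !mulrNz crealN -!pmulrn creal_nat.
Qed.

(** The imaginary part is reduced to y in [0, 2 pi). There cos y = 1 gives sin (y / 2) = 0, and
    since sin is positive on (0, pi) the half angle leaves only y = 0. *)
Lemma cexp_eq1 z : cexp z = 1 -> exists k : int, z = ci * creal (pi *+ 2) * k%:~R.
Proof.
move=> z1.
have x0 : Re z = 0.
  by apply: expR_inj; rewrite expR0 -cmod_cexp z1 cmod1.
pose k := Num.floor (Im z / (pi *+ 2)).
have p0 : 0 < (pi : R) *+ 2 by rewrite mulrn_wgt0 // pi_gt0.
pose y := Im z - pi *+ 2 * k%:~R.
have y0 : 0 <= y.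
  rewrite subr_ge0 mulrC -ler_pdivlMr //; exact: floor_le_tmp.
have y1 : y < pi *+ 2.
  have h : Im z < (k + 1)%:~R * (pi *+ 2).
    by rewrite -ltr_pdivrMr //; exact: floorD1_gt.
  by move: h; rewrite intrD mulrDl mul1r /y; lra.
have ey : cexp (ci * creal y) = 1.
  have -> : ci * creal y = z - ci * creal (pi *+ 2) * k%:~R.
    rewrite /y crealD crealN crealM creal_int {2}(cpair_ReIm z) cpairE x0 creal0.
    by ring.
  by rewrite cexpD cexpNV z1 cexp_2pi_int invr1 mulr1.
have cy : cos y = 1.
  have := congr1 (@complex.Re R) ey.
  by rewrite !(cexpE, ReImE, mul0r, mul1r, subr0, add0r) expR0 mul1r.
have s0 : sin (y / 2) = 0.
  have : cos ((y / 2) *+ 2) = 1 by rewrite -mulr_natr divfK.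
  rewrite cos_mulr2n cos2sin2 => h; apply/eqP; rewrite -sqrf_eq0; apply/eqP.
  by move: h; lra.
exists k; rewrite {1}(cpair_ReIm z) cpairE x0 creal0 add0r -mulrA -creal_int -crealM.
congr (_ * creal _); apply/eqP; rewrite -subr_eq0 -/y; apply: contraTT isT => yn0.
have : 0 < sin (y / 2).
  apply: sin_gt0_pi; move: y1; rewrite mulr2n => y1.
  by have : 0 < y; [rewrite lt_def yn0 | lra].
by rewrite s0 ltxx.
Qed.

End Exponential.

(** * Cauchy's estimate and Liouville's theorem *)

Section Entire.
Context {R : realType}.
Local Notation C := (CC R).
Local Notation Re := complex.Re.
Local Notation Im := complex.Im.

Definition entire (f : C -> C) := forall z : C, derivable f z 1.

Lemma entire_continuous f : entire f -> continuous f.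
Proof. by move=> df z; exact: derivable_continuousC. Qed.

Lemma derivable_compC (f g : C -> C) (z : C) :
  derivable g z 1 -> derivable f (g z) 1 -> derivable (fun w => f (g w)) z 1.
Proof.
move=> /derivable1_diffP dg /derivable1_diffP df.
have h : differentiable (f \o g) z := differentiable_comp dg df.
by have /derivable1_diffP := h.
Qed.

Lemma entire_comp f g : entire f -> entire g -> entire (fun z => f (g z)).
Proof. by move=> df dg z; apply: derivable_compC. Qed.

Lemma entire_cst (c : C) : entire (fun=> c).
Proof. by move=> z; exact: derivable_cst. Qed.

Lemma entire_id : entire id.
Proof. by move=> z; exact: derivable_id. Qed.

Lemma entireD f g : entire f -> entire g -> entire (fun z => f z + g z).
Proof. by move=> df dg z; apply: derivableD. Qed.

Lemma entireB f g : entire f -> entire g -> entire (fun z => f z - g z).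
Proof. by move=> df dg z; apply: derivableB. Qed.

Lemma entireM f g : entire f -> entire g -> entire (fun z => f z * g z).
Proof. by move=> df dg z; apply: derivableM. Qed.

Lemma entire_cexp : entire (@cexp R).
Proof. by move=> z; have [] := is_derive_cexp z. Qed.

Lemma entire_shift f (a : C) : entire f -> entire (fun z => f (z + a)).
Proof.
move=> df; apply: entire_comp df _.
by apply: entireD; [exact: entire_id | exact: entire_cst].
Qed.

Lemma derive_shiftC f (a z : C) : entire f ->
  'D_1 (fun w => f (w + a)) z = 'D_1 f (z + a).
Proof.
move=> df; have /derivableP/is_deriveC h := df (z + a).
suff /@derive_val : is_derive z 1 (fun w => f (w + a)) ('D_1 f (z + a)) by [].
apply/is_deriveC => e /h[d d0 hd]; exists d => // w wz.
have := hd (w + a); rewrite opprD addrACA subrr addr0; exact.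
Qed.

Lemma deriveBC f g (z : C) : entire f -> entire g ->
  'D_1 (fun w => f w - g w) z = 'D_1 f z - 'D_1 g z.
Proof. by move=> df dg; exact: deriveB. Qed.

Lemma deriveMlC f (c z : C) : entire f ->
  'D_1 (fun w => c * f w) z = c * 'D_1 f z.
Proof.
move=> df; have -> : (fun w => c * f w) = c *: f by [].
by rewrite deriveZ.
Qed.

(* Goursat's theorem for the [2 i pi]-periodic function
   [(f (z0 + exp w) - f z0) / exp w] shows that its mean over vertical periods
   does not depend on the abscissa; on the left it tends to [f' z0]. *)
Lemma cauchy_estimate f (z0 : C) (r M : R) : entire f -> 0 < r ->
  (forall w, cmod (w - z0) = r -> cmod (f w - f z0) <= M) ->
  cmod ('D_1 f z0) <= 2 * (M / r).
Proof.
move=> df r0 hM; set L := 'D_1 f z0.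
pose g z := (f (z0 + cexp z) - f z0) * (cexp z)^-1.
have dg : entire g.
  apply: entireM.
    apply: entireB; last exact: entire_cst.
    apply: (entire_comp df (g := fun z => z0 + cexp z)).
    by apply: entireD; [exact: entire_cst | exact: entire_cexp].
  move=> z; apply: derivableV; first exact: cexp_neq0.
  exact: entire_cexp.
pose p : R := pi *+ 2.
have p0 : 0 < p by rewrite /p mulrn_wgt0 // pi_gt0.
have gper z : g (z + ci * creal p) = g z by rewrite /g cexp_periodic.
pose V x := vint g x 0 p.
have Vp x : V (x + p) = V x by exact: vint_periodic.
have Vn n x : V (x - p *+ n) = V x.
  elim: n => [|n IH]; first by rewrite subr0.
  rewrite -IH -(Vp (x - p *+ n.+1)); congr V.
  by rewrite (mulrS p n); ring.
have gc x : ccont (fun t => g (cpair x t)).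
  by apply: (ccont_comp (entire_continuous dg) ltr01) => s t; rewrite cmod_vert mul1r.
have mg x t : cmod (cexp (cpair x t : C)) = expR x by rewrite cmod_cexp.
have V1 : cmod (V (ln r)) <= 2 * (M / r * p).
  have := @cint_affine _ (fun t => g (cpair (ln r) t)) 0 0 (M / r) 0 p (gc _) (ltW p0).
  rewrite !mul0r addr0 subr0 subr0 /V /vint add0r; apply => t _.
  rewrite mul0r addr0 subr0 /g cmodM cmodV mg lnK // ler_pM2r ?invr_gt0 //.
  by apply: hM; rewrite addrC addKr mg lnK.
apply/ler_addgt0Pr => e e0.
have e20 : 0 < e / 2 by lra.
have /derivableP/is_deriveC/(_ _ e20)[d d0 hd] := df z0.
have V2 x : expR x < d -> cmod (V x - L * creal p) <= 2 * (e / 2 * p).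
  move=> xd.
  have := @cint_affine _ (fun t => g (cpair x t)) L 0 (e / 2) 0 p (gc _) (ltW p0).
  rewrite !mul0r addr0 subr0 /V /vint add0r; apply => t _.
  have := hd (z0 + cexp (cpair x t)); rewrite (addrC z0) addrK mg => /(_ xd).
  rewrite mul0r addr0 -ler_pdivrMr ?expR_gt0 // -(mg x t) -cmodV -cmodM.
  rewrite mulrBl mulfK ?cexp_neq0 // /g (addrC z0); exact.
(* The abscissa can be moved only by multiples of the period; enough of them shrink the circle into
   the disc where the difference quotient is close to [L]. *)
have [n hn] : exists n, expR (ln r - p *+ n) < d.
  pose n := Num.bound `|(ln r - ln d) / p|.
  exists n; rewrite -(lnK d0) ltr_expR.
  have : (ln r - ln d) / p < n%:R.
    by apply: le_lt_trans (ler_norm _) _; exact: archi_boundP (normr_ge0 _).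
  by rewrite ltr_pdivrMr // mulr_natl; lra.
have {V2} := V2 _ hn; rewrite Vn => V2.
have : cmod (L * creal p) <= 2 * (M / r * p) + 2 * (e / 2 * p).
  have -> : L * creal p = V (ln r) - (V (ln r) - L * creal p) by ring.
  by apply: le_trans (cmodB _ _) _; exact: lerD.
rewrite cmodM cmod_creal ger0_norm ?(ltW p0) //.
have -> : 2 * (M / r * p) + 2 * (e / 2 * p) = (2 * (M / r) + e) * p.
  by field; rewrite gt_eqF.
by rewrite ler_pM2r.
Qed.

(** The real mean value theorem is applied to the real and to the imaginary part along the segment,
    at two different points; hence the factor 2. In the proof, [p] stands for either part. *)
Lemma cmvt f (u v : C) (M : R) : entire f ->
  (forall t, 0 <= t <= 1 -> cmod ('D_1 f (u + creal t * (v - u))) <= M) ->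
  cmod (f v - f u) <= 2 * (M * cmod (v - u)).
Proof.
move=> df hM; set k := v - u.
have H (p : C -> R) : (forall z w, p (z + w) = p z + p w) ->
    (forall z, p (- z) = - p z) -> (forall x z, p (z * creal x) = p z * x) ->
    (forall z, `|p z| <= cmod z) ->
    `|p (f v - f u)| <= M * cmod k.
  move=> pD pN pZ ple; pose gam (t : R) : C := u + creal t * k.
  have dg (t : R) : is_derive t 1 (fun s => p (f (gam s))) (p ('D_1 f (gam t) * k)).
    apply/is_deriveR => e e0.
    have k0 : 0 < cmod k + 1 by have := cmod_ge0 k; lra.
    have /derivableP/is_deriveC/(_ _ (divr_gt0 e0 k0))[d d0 hd] := df (gam t).
    exists (d / (cmod k + 1)); first by rewrite divr_gt0.
    move=> s; rewrite ltr_pdivlMr // => st.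
    have E : gam s - gam t = creal (s - t) * k.
      by rewrite /gam crealD crealN; ring.
    have cE : cmod (gam s - gam t) <= `|s - t| * (cmod k + 1).
      by rewrite E cmodM cmod_creal ler_wpM2l // lerDl.
    have := hd (gam s) (le_lt_trans cE st).
    set A := (X in cmod X <= _); move=> hA.
    have -> : p (f (gam s)) - p (f (gam t)) - p ('D_1 f (gam t) * k) * (s - t) = p A.
      rewrite -pZ -pN -pD -pN -pD /A E; congr p; ring.
    apply: le_trans (ple _) _; apply: le_trans hA _.
    apply: le_trans (ler_wpM2l (ltW (divr_gt0 e0 k0)) cE) _.
    by rewrite mulrCA divfK ?gt_eqF // mulrC.
  have cont : {within `[0, 1], continuous (fun s => p (f (gam s)))}.
    apply: continuous_subspaceT => t.
    by apply/differentiable_continuous/derivable1_diffP; have [] := dg t.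
  have [c] := MVT_segment (@ler01 R) (fun t _ => dg t) cont.
  rewrite in_itv /= subr0 mulr1 => hc.
  have -> : gam 1 = v by rewrite /gam creal1 mul1r /k addrC subrK.
  have -> : gam 0 = u by rewrite /gam creal0 mul0r addr0.
  rewrite -pN -pD => ->; apply: le_trans (ple _) _.
  by rewrite cmodM ler_wpM2r ?cmod_ge0 //; exact: hM.
apply: le_trans (cmod_le_ReIm _) _.
have h1 : `|Re (f v - f u)| <= M * cmod k.
  apply: H => [z w|z|x z|z]; rewrite ?ReImE //; first by rewrite mulr0 subr0.
  exact: Re_le_cmod.
have h2 : `|Im (f v - f u)| <= M * cmod k.
  apply: H => [z w|z|x z|z]; rewrite ?ReImE //; first by rewrite mulr0 add0r.
  exact: Im_le_cmod.
lra.
Qed.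

Lemma liouville f (M : R) : entire f -> (forall z, cmod (f z) <= M) ->
  forall z w, f z = f w.
Proof.
move=> df hM.
have D0 z : 'D_1 f z = 0.
  apply/eqP; rewrite -cmod_eq0 eq_le cmod_ge0 andbT.
  apply/ler_addgt0Pr => e e0; rewrite add0r.
  have M0 : 0 <= M by apply: le_trans (hM 0); exact: cmod_ge0.
  (* The oscillation is at most 2M, so the estimate reads 4M / r = e * M / (M + 1), below e. The
     added 1 keeps r positive when M = 0. *)
  pose r := 4 * (M + 1) / e.
  have r0 : 0 < r by rewrite /r divr_gt0 //; lra.
  have := @cauchy_estimate f z r (2 * M) df r0.
  have -> : 2 * (2 * M / r) = e * (M / (M + 1)).
    by rewrite /r; field; rewrite !gt_eqF //; lra.
  move=> /(_ _)/le_trans; apply => [w _|].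
    by apply: le_trans (cmodB _ _) _; have := hM w; have := hM z; lra.
  rewrite ger_pMr // ler_pdivrMr; lra.
move=> z w; apply/eqP; rewrite -subr_eq0 -cmod_eq0 eq_le cmod_ge0 andbT.
have := @cmvt f w z 0 df; rewrite !mul0r mulr0; apply => t _.
by rewrite D0 cmod0.
Qed.

End Entire.

(** * Limits and zeros of entire functions *)

Section EntireLimits.
Context {R : realType}.
Local Notation C := (CC R).
Local Notation Re := complex.Re.
Local Notation Im := complex.Im.

(** Compactness by bisection: boundedness passes from four quarters to their union and holds on
    small squares by continuity. *)
Lemma continuous_bounded (f : C -> C) (r : R) : continuous f ->
  exists M, forall z, cmod z <= r -> cmod (f z) <= M.
Proof.
move=> cf; pose P a s := exists M : R, forall z, in_square a s z -> cmod (f z) <= M.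
have r0 : 0 < `|r| + 1 by have := normr_ge0 r; lra.
suff [M hM] : P (- (creal (`|r| + 1) + ci * creal (`|r| + 1))) (2 * (`|r| + 1)).
  exists M => z zr; apply: hM; rewrite /in_square !ReImE.
  have := Re_le_cmod z; have := Im_le_cmod z; have := ler_norm r.
  by rewrite !ler_norml; lra.
apply: (square_ind (P := P)); last by lra.
  move=> a s s0 [M1 h1] [M2 h2] [M3 h3] [M4 h4].
  exists (Num.max (Num.max M1 M2) (Num.max M3 M4)) => z [z1 z2].
  rewrite !le_max.
  have [x1|x1] := leP (Re z) (Re a + s); have [y1|y1] := leP (Im z) (Im a + s).
  - by rewrite h1 //; split; rewrite ?ReImE; lra.
  - by rewrite h3 ?orbT //; split; rewrite ?ReImE; lra.
  - by rewrite h2 ?orbT //; split; rewrite ?ReImE; lra.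
  - by rewrite h4 ?orbT //; split; rewrite ?ReImE; lra.
move=> z; have [d d0 hd] := (continuousC _ _).1 (cf z) _ ltr01.
exists (d / 2); first by lra.
move=> a s s0 sd az; exists (cmod (f z) + 1) => w aw.
have wz : cmod (w - z) < d by apply: le_lt_trans (in_square_dist az aw) _; lra.
rewrite -(subrK (f z) (f w)); apply: le_trans (cmodD _ _) _.
by have := hd w wz; lra.
Qed.

Lemma cmod_le_sub (z w : C) (r s : R) :
  cmod (z - w) <= r -> cmod w <= s -> cmod z <= r + s.
Proof.
by move=> h1 h2; rewrite -(subrK w z); apply: le_trans (cmodD _ _) _; exact: lerD.
Qed.

Lemma derive_bound (f : C -> C) (u : C) (r M : R) : entire f -> 0 < r ->
  (forall w, cmod (w - u) <= r -> cmod (f w) <= M) ->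
  cmod ('D_1 f u) <= 4 * (M / r).
Proof.
move=> df r0 hM; have -> : 4 * (M / r) = 2 * (2 * M / r) by ring.
apply: cauchy_estimate => // w wu; apply: le_trans (cmodB _ _) _.
have := hM w; rewrite wu lexx => /(_ isT).
by have := hM u; rewrite subrr cmod0 ltW // => /(_ isT); lra.
Qed.

(** A second derivative is not yet available. Its place is taken by a Lipschitz bound for f',
    obtained from [derive_bound] for the increment w |-> f (w + k) - f w. The argument uses up one
    radius [r] for each of w, k and the disc of the derivative bound, hence [3 * r]. *)
Lemma taylor_bound (f : C -> C) (u h : C) (r M : R) : entire f -> 0 < r ->
  (forall w, cmod (w - u) <= 3 * r -> cmod (f w) <= M) -> cmod h <= r ->
  cmod (f (u + h) - f u - 'D_1 f u * h) <= 64 * (M / r ^+ 2) * cmod h ^+ 2.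
Proof.
move=> df r0 hM hr.
have M0 : 0 <= M.
  apply: le_trans (hM u _); first exact: cmod_ge0.
  by rewrite subrr cmod0; lra.
have D1 v : cmod (v - u) <= 2 * r -> cmod ('D_1 f v) <= 4 * (M / r).
  move=> vu; apply: (derive_bound df r0) => w wv; apply: hM.
  have -> : w - u = (w - v) + (v - u) by ring.
  by apply: le_trans (cmodD _ _) _; lra.
have D2 k : cmod k <= r ->
    cmod ('D_1 f (u + k) - 'D_1 f u) <= 32 * (M / r ^+ 2) * cmod k.
  move=> kr; pose g w := f (w + k) - f w.
  have dfk := @entire_shift _ f k df.
  have gE : 'D_1 g u = 'D_1 f (u + k) - 'D_1 f u.
    by have := deriveBC u dfk df; rewrite derive_shiftC.
  have bg w : cmod (w - u) <= r -> cmod (g w) <= 8 * (M / r) * cmod k.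
    move=> wu; have -> : 8 * (M / r) * cmod k = 2 * (4 * (M / r) * cmod (w + k - w)).
      by rewrite addrAC subrr add0r; ring.
    apply: (cmvt df) => t t01; apply: D1.
    have -> : w + creal t * (w + k - w) - u = (w - u) + creal t * k by ring.
    apply: le_trans (cmodD _ _) _; rewrite cmodM cmod_creal ger0_norm; last by lra.
    have : t * cmod k <= 1 * r by apply: ler_pM => //; [lra | exact: cmod_ge0 | lra].
    by lra.
  rewrite -gE.
  have -> : 32 * (M / r ^+ 2) * cmod k = 4 * ((8 * (M / r) * cmod k) / r).
    by field; rewrite gt_eqF.
  exact: (derive_bound (entireB dfk df) r0 bg).
pose phi w := f w - 'D_1 f u * w.
have dl : entire (fun w => 'D_1 f u * w).
  by apply: entireM; [exact: entire_cst | exact: entire_id].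
have dphi : entire phi := entireB df dl.
have phiE w : 'D_1 phi w = 'D_1 f w - 'D_1 f u.
  rewrite (deriveBC _ df dl) (deriveMlC _ _ (@entire_id R)).
  by rewrite derive_id mulr1.
have -> : f (u + h) - f u - 'D_1 f u * h = phi (u + h) - phi u.
  by rewrite /phi; ring.
have -> : 64 * (M / r ^+ 2) * cmod h ^+ 2 =
   2 * (32 * (M / r ^+ 2) * cmod h * cmod (u + h - u)).
  by rewrite addrAC subrr add0r; ring.
apply: (cmvt dphi) => t t01; rewrite phiE.
have -> : u + creal t * (u + h - u) = u + creal t * h by ring.
have th : cmod (creal t * h) <= cmod h.
  rewrite cmodM cmod_creal ger0_norm; last by lra.
  by rewrite ler_piMl ?cmod_ge0 //; lra.
apply: le_trans (D2 _ (le_trans th hr)) _.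
by rewrite ler_wpM2l // mulr_ge0 // divr_ge0 // exprn_ge0 // ltW.
Qed.

Definition loc_unif_cvg (F : nat -> C -> C) (f : C -> C) :=
  forall r e : R, 0 < e -> exists N, forall n, (N <= n)%N ->
    forall z, cmod z <= r -> cmod (F n z - f z) <= e.

(** By Cauchy's estimate the derivatives of [F n] are uniformly Cauchy near [u]; their limit [l] at
    [u] is the derivative of [f]. *)
Lemma weierstrass (F : nat -> C -> C) (f : C -> C) :
  (forall n, entire (F n)) -> loc_unif_cvg F f -> entire f.
Proof.
move=> dF cF u; pose r := cmod u + 2.
have near_u v w : cmod (v - u) <= 1 -> cmod (w - v) <= 1 -> cmod w <= r.
  move=> h1 h2; rewrite -(subrK v w) -{2}(subrK u v).
  apply: le_trans (cmodD _ _) _.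
  by have := cmodD (v - u) u; rewrite /r; lra.
have D (e : R) : 0 < e -> exists N, forall m n, (N <= m)%N -> (N <= n)%N ->
    forall v, cmod (v - u) <= 1 -> cmod ('D_1 (F m) v - 'D_1 (F n) v) <= e.
  move=> e0; have e8 : 0 < e / 8 by lra.
  have [N hN] := cF r _ e8; exists N => m n Nm Nn v vu.
  rewrite -(deriveBC _ (@dF m) (@dF n)).
  have -> : e = 4 * (2 * (e / 8) / 1) by field.
  apply: (derive_bound (entireB (@dF m) (@dF n)) ltr01).
  move=> w wv; have wr := near_u _ _ vu wv.
  have -> : F m w - F n w = (F m w - f w) - (F n w - f w) by ring.
  apply: le_trans (cmodB _ _) _; have := hN m Nm w wr; have := hN n Nn w wr; lra.
have [l hl] : exists l, forall e : R, 0 < e -> exists N, forall n, (N <= n)%N ->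
    cmod ('D_1 (F n) u - l) <= e.
  apply: complete_cmod => e /D[N hN]; exists N => m n Nm Nn.
  by apply: hN => //; rewrite subrr cmod0.
suff : is_derive u 1 f l by case.
(* Two quarters go to the increment of f - F n, one to the differentiability of [F n], one to the
   distance from its derivative to [l]. *)
apply/is_deriveC => e e0; pose eta := e / 4; have eta0 : 0 < eta by rewrite /eta; lra.
have [N1 h1] := D _ eta0; have [N2 h2] := hl _ eta0.
pose n := maxn N1 N2.
have /derivableP/is_deriveC/(_ _ eta0)[d d0 hd] := @dF n u.
exists (Num.min d 1); first by rewrite lt_min d0 ltr01.
move=> w; rewrite lt_min => /andP[wd w1].
pose k := w - u.
(* The mean value inequality bounds the increment of F m - F n uniformly in m; letting m grow
   replaces [F m] by [f] at the cost of an arbitrary [e']. *)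
have tail : cmod ((f w - F n w) - (f u - F n u)) <= 2 * (eta * cmod k).
  apply/ler_addgt0Pr => e' e'0; have e2 : 0 < e' / 2 by lra.
  have [N3 h3] := cF r _ e2; pose m := maxn N1 N3.
  have wr : cmod w <= r by apply: (near_u u) => //; rewrite ?subrr ?cmod0 // ltW.
  have ur : cmod u <= r by apply: (near_u u) => //; rewrite ?subrr ?cmod0.
  have hm z : cmod z <= r -> cmod (F m z - f z) <= e' / 2.
    by move=> zr; apply: h3 => //; rewrite leq_max leqnn orbT.
  have A : cmod ((F m w - F n w) - (F m u - F n u)) <= 2 * (eta * cmod k).
    apply: (cmvt (entireB (@dF m) (@dF n))).
    move=> t t01; rewrite (deriveBC _ (@dF m) (@dF n)).
    apply: h1; rewrite ?leq_max ?leqnn //.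
    rewrite addrAC subrr add0r cmodM cmod_creal ger0_norm; last by lra.
    have : t * cmod (w - u) <= 1 * 1.
      by apply: ler_pM => //; [lra | exact: cmod_ge0 | lra | exact: ltW].
    by rewrite mulr1.
  have -> : (f w - F n w) - (f u - F n u) =
    ((F m w - F n w) - (F m u - F n u)) - ((F m w - f w) - (F m u - f u)) by ring.
  apply: le_trans (cmodB _ _) _.
  have := cmodB (F m w - f w) (F m u - f u).
  have := hm _ wr; have := hm _ ur; lra.
have -> : f w - f u - l * (w - u) = ((f w - F n w) - (f u - F n u)) +
   ((F n w - F n u - 'D_1 (F n) u * (w - u)) + ('D_1 (F n) u - l) * (w - u)) by ring.
apply: le_trans (cmodD _ _) _.
have := cmodD (F n w - F n u - 'D_1 (F n) u * (w - u)) (('D_1 (F n) u - l) * (w - u)).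
have := hd w wd.
have : cmod (('D_1 (F n) u - l) * (w - u)) <= eta * cmod (w - u).
  by rewrite cmodM ler_wpM2r ?cmod_ge0 //; apply: h2; rewrite leq_max leqnn orbT.
have -> : e * cmod (w - u) = 4 * (eta * cmod (w - u)) by rewrite /eta; field.
move: tail; rewrite -/k; lra.
Qed.

(* The derivative is the locally uniform limit of difference quotients. *)
Lemma entire_derive (f : C -> C) : entire f -> entire (fun z => 'D_1 f z).
Proof.
move=> df; pose F (n : nat) z := n.+1%:R * (f (z + n.+1%:R^-1) - f z) : C.
apply: (@weierstrass F).
  move=> n; apply: entireM; first exact: entire_cst.
  exact: (entireB (entire_shift df) df).
move=> r e e0.
(* [taylor_bound] at radius 1 looks at the disc of radius 3 around [z]. Its remainder is of order 1
   / n ^ 2, which beats the factor n of the difference quotient. *)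
have [M hM] := continuous_bounded (r + 3) (entire_continuous df).
have M0 : 0 <= `|M| by [].
exists (Num.bound (64 * (`|M| + 1) / e)) => n hn z zr.
have n0 : 0 < n.+1%:R :> R by [].
have nE : n.+1%:R = creal n.+1%:R :> C by rewrite creal_nat.
have h1 : cmod (n.+1%:R^-1 : C) = n.+1%:R^-1.
  by rewrite cmodV nE cmod_creal ger0_norm.
have := @taylor_bound f z n.+1%:R^-1 1 (`|M| + 1) df ltr01.
rewrite h1 invf_le1 // ler1n => /(_ _ isT) T.
have nz : n.+1%:R != 0 :> C by rewrite nE creal_eq0 gt_eqF.
have -> : F n z - 'D_1 f z =
   n.+1%:R * (f (z + n.+1%:R^-1) - f z - 'D_1 f z * n.+1%:R^-1).
  by rewrite /F [RHS]mulrBr [in RHS]mulrCA (divff nz) mulr1.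
rewrite cmodM {1}nE cmod_creal ger0_norm //.
have : n.+1%:R * cmod (f (z + n.+1%:R^-1) - f z - 'D_1 f z * n.+1%:R^-1) <=
   n.+1%:R * (64 * ((`|M| + 1) / 1 ^+ 2) * n.+1%:R^-1 ^+ 2).
  rewrite ler_pM2l //; apply: T => w wz.
  have : cmod (f w) <= M.
    apply: hM; rewrite addrC; apply: cmod_le_sub zr; lra.
  have := ler_norm M; lra.
move=> H.
apply: (le_trans H).
have -> : n.+1%:R * (64 * ((`|M| + 1) / 1 ^+ 2) * n.+1%:R^-1 ^+ 2)
   = 64 * (`|M| + 1) / n.+1%:R by field; rewrite gt_eqF.
rewrite ler_pdivrMr // [leRHS]mulrC -ler_pdivrMr //.
have x0 : 0 <= 64 * (`|M| + 1) / e by rewrite divr_ge0 //; lra.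
apply: le_trans (ltW (archi_boundP x0)) _.
by rewrite ler_nat; exact: leqW.
Qed.

(** Only differentiability of the quotient at [p] is at stake. Its derivative there is f''(p) / 2,
    as the mean value inequality shows for f minus its second Taylor polynomial [phi], whose
    derivative is small against the distance to [p]. *)
Lemma entire_factor (f : C -> C) (p : C) : entire f -> f p = 0 ->
  exists k : C -> C, [/\ entire k, forall z, f z = (z - p) * k z & k p = 'D_1 f p].
Proof.
move=> df fp; pose k z := if z == p then 'D_1 f p else f z / (z - p).
have kE z : f z = (z - p) * k z.
  rewrite /k; have [->|zp] := eqVneq z p; first by rewrite subrr mul0r.
  by rewrite mulrC divfK // subr_eq0.
exists k; split; [|exact: kE|by rewrite /k eqxx].
move=> z; have [->{z}|zp] := eqVneq z p; last first.
  have dq : derivable (fun w => f w * (w - p)^-1) z 1.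
    apply: (derivableM (@df z)); apply: derivableV; first by rewrite subr_eq0.
    by apply: entireB; [exact: entire_id | exact: entire_cst].
  suff : {near z, (fun w => f w * (w - p)^-1) =1 k}.
    by move=> /near_eq_derivable; apply; rewrite ?oner_eq0.
  apply/nearC; exists (cmod (z - p)); first by rewrite cmod_gt0 subr_eq0.
  move=> w wz; rewrite /k; case: eqVneq => // wp.
  by move: wz; rewrite wp cmod_distC ltxx.
have d2f := entire_derive df.
pose c2 := 'D_1 (fun z => 'D_1 f z) p.
suff : is_derive p 1 k (c2 / 2) by case.
apply/is_deriveC => e e0; have e2 : 0 < e / 2 by lra.
have /derivableP/is_deriveC/(_ _ e2)[d d0 hd] := @d2f p.
exists d => // w wp; have [->|wnp] := eqVneq w p.
  by rewrite !subrr mulr0 subr0 cmod0 mulr0.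
pose phi z := f z - ('D_1 f p * (z - p) + c2 / 2 * ((z - p) * (z - p))).
have dphi (z : C) : is_derive z 1 phi ('D_1 f z - 'D_1 f p - c2 * (z - p)).
  have dzp : is_derive z 1 (fun z => z - p) 1.
    by have := is_deriveB (is_derive_id z 1) (is_derive_cst p z 1); rewrite subr0.
  have d2 : is_derive z 1 (fun z => (z - p) * (z - p))
     ((z - p) * 1 + (z - p) * 1) by exact: (is_deriveM dzp dzp).
  have d1 : is_derive z 1 (fun z => 'D_1 f p * (z - p)) ('D_1 f p * 1).
    exact: (is_deriveZ _ dzp).
  have d3 : is_derive z 1 (fun z => c2 / 2 * ((z - p) * (z - p)))
     (c2 / 2 * ((z - p) * 1 + (z - p) * 1)) by exact: (is_deriveZ _ d2).
  have d5 := is_deriveB (derivableP (@df z)) (is_deriveD d1 d3).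
  have E : 'D_1 f z - 'D_1 f p - c2 * (z - p) = 'D_1 f z -
     ('D_1 f p * 1 + c2 / 2 * ((z - p) * 1 + (z - p) * 1)).
    have half (x y t : C) : x - y - t * (z - p) = x -
        (y * 1 + t / 2 * ((z - p) * 1 + (z - p) * 1)) by field.
    exact: half.
  by rewrite E; exact: d5.
have dphi0 : entire phi by move=> z; have [] := dphi z.
have phiE z : 'D_1 phi z = 'D_1 f z - 'D_1 f p - c2 * (z - p).
  by have [] := dphi z.
have B : cmod (phi w - phi p) <= 2 * (e / 2 * cmod (w - p) * cmod (w - p)).
  apply: (cmvt dphi0) => t t01; rewrite phiE.
  have E : p + creal t * (w - p) - p = creal t * (w - p) by ring.
  have le1 : cmod (creal t * (w - p)) <= cmod (w - p).
    rewrite cmodM cmod_creal ger0_norm; last by lra.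
    by rewrite ler_piMl ?cmod_ge0 //; lra.
  apply: le_trans (hd _ _) _; rewrite E; first exact: le_lt_trans le1 wp.
  by rewrite ler_pM2l.
have wp0 : 0 < cmod (w - p) by rewrite cmod_gt0 subr_eq0.
have -> : k w - k p - c2 / 2 * (w - p) = (phi w - phi p) / (w - p).
  rewrite /phi fp /k eqxx (negbTE wnp); field.
  by rewrite subr_eq0.
rewrite cmodM cmodV ler_pdivrMr //.
by apply: le_trans B _; lra.
Qed.

End EntireLimits.

(** * The product of 1 - q ^+ k * w over k >= 0 *)

Section EulerProduct.
Context {R : realType}.
Local Notation C := (CC R).
Variable q : C.
Hypothesis q1 : cmod q < 1.

(** The finite q-Pochhammer symbol (w; q)_n; [euler_prod] is its limit (w; q)_infinity. *)
Definition qprod n (w : C) : C := \prod_(k < n) (1 - q ^+ k * w).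

Let Q := cmod q.
Let Q0 : 0 <= Q. Proof. exact: cmod_ge0. Qed.
Let Q1 : 0 < 1 - Q. Proof. by rewrite subr_gt0. Qed.

Lemma qprodS n w : qprod n.+1 w = qprod n w * (1 - q ^+ n * w).
Proof. by rewrite /qprod big_ord_recr. Qed.

Lemma qprod_shift n w : qprod n.+1 w = (1 - w) * qprod n (q * w).
Proof.
rewrite /qprod big_ord_recl expr0 mul1r; congr (_ * _).
by apply: eq_bigr => i _; rewrite /= exprSr mulrA.
Qed.

Lemma entire_qprod n : entire (qprod n).
Proof.
elim: n => [|n IH].
  have -> : qprod 0 = fun=> 1 by apply/funext => w; rewrite /qprod big_ord0.
  exact: entire_cst.
have -> : qprod n.+1 = fun w => qprod n w * (1 - q ^+ n * w).
  by apply/funext => w; rewrite qprodS.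
apply: entireM IH _; apply: entireB; first exact: entire_cst.
exact: (entireM (@entire_cst _ _) (@entire_id R)).
Qed.

Lemma qprod_bound n w (r : R) : cmod w <= r ->
  cmod (qprod n w) <= expR (r / (1 - Q)).
Proof.
move=> wr; have r0 : 0 <= r by apply: le_trans wr; exact: cmod_ge0.
(* The induction follows the partial geometric sum; each factor is bounded by 1 + x <= exp x. *)
suff : cmod (qprod n w) <= expR (r * (1 - Q ^+ n) / (1 - Q)).
  move=> /le_trans; apply; rewrite ler_expR ler_pM2r ?invr_gt0 //.
  by rewrite ler_piMr // gerBl exprn_ge0.
elim: n => [|n IH].
  by rewrite /qprod big_ord0 cmod1 expr0 subrr mulr0 mul0r expR0.
rewrite qprodS cmodM.
have -> : r * (1 - Q ^+ n.+1) / (1 - Q) = r * (1 - Q ^+ n) / (1 - Q) + Q ^+ n * r.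
  by rewrite exprS; field; rewrite gt_eqF.
rewrite expRD; apply: ler_pM => //; try exact: cmod_ge0.
apply: le_trans (cmodB _ _) _; rewrite cmod1 cmodM cmodX.
apply: le_trans (expR_ge1Dx _); rewrite lerD2l.
by rewrite ler_wpM2l // exprn_ge0.
Qed.

Let K (r : R) := expR (r / (1 - Q)) * r / (1 - Q).

(** Consecutive products differ by [qprod n w * (q ^+ n * w)], a geometrically small term. Induction
    on [m] carries the exact partial sum of the geometric series. *)
Lemma qprod_cauchy m n w (r : R) : cmod w <= r ->
  cmod (qprod (n + m) w - qprod n w) <= K r * Q ^+ n.
Proof.
move=> wr; have r0 : 0 <= r by apply: le_trans wr; exact: cmod_ge0.
have K0 : 0 <= K r.
  by rewrite /K divr_ge0 ?(ltW Q1) // mulr_ge0 // expR_ge0.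
suff : cmod (qprod (n + m) w - qprod n w) <= K r * (Q ^+ n - Q ^+ (n + m)).
  move=> /le_trans; apply; rewrite ler_wpM2l //.
  by rewrite gerBl exprn_ge0.
elim: m => [|m IH]; first by rewrite addn0 !subrr cmod0 mulr0.
rewrite addnS qprodS.
have -> : qprod (n + m) w * (1 - q ^+ (n + m) * w) - qprod n w =
  (qprod (n + m) w - qprod n w) - qprod (n + m) w * (q ^+ (n + m) * w) by ring.
apply: le_trans (cmodB _ _) _.
have -> : K r * (Q ^+ n - Q ^+ (n + m).+1) = K r * (Q ^+ n - Q ^+ (n + m)) +
    expR (r / (1 - Q)) * (Q ^+ (n + m) * r).
  by rewrite /K exprS; field; rewrite gt_eqF.
apply: lerD => //; rewrite !cmodM cmodX.
apply: ler_pM; rewrite ?cmod_ge0 ?mulr_ge0 ?cmod_ge0 ?exprn_ge0 //.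
  exact: qprod_bound.
by rewrite ler_wpM2l // exprn_ge0.
Qed.

Lemma geometric_small (A e : R) : 0 < e -> exists N, forall n, (N <= n)%N ->
  A * Q ^+ n <= e.
Proof.
move=> e0; have Qn : `|Q| < 1 by rewrite ger0_norm.
have /cvgrPdist_le/(_ _ e0)[N _ hN] := cvg_geometric A Qn.
exists N => n Nn; have := hN n Nn; rewrite /= sub0r normrN.
by apply: le_trans; exact: ler_norm.
Qed.

Lemma qprod_cvg w : exists l, forall e : R, 0 < e -> exists N, forall n, (N <= n)%N ->
  cmod (qprod n w - l) <= e.
Proof.
apply: complete_cmod => e e0; have [N hN] := geometric_small (K (cmod w)) e0.
suff H m n : (N <= m)%N -> (m <= n)%N -> cmod (qprod n w - qprod m w) <= e.
  exists N => m n Nm Nn; have [mn|/ltnW nm] := leqP m n; last exact: H.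
  by rewrite cmod_distC; exact: H.
move=> Nm mn; rewrite -(subnKC mn).
by apply: le_trans (qprod_cauchy _ _ (lexx _)) _; exact: hN.
Qed.

Definition euler_prod (w : C) : C := sval (cid (qprod_cvg w)).

Lemma euler_prodP w (e : R) : 0 < e -> exists N, forall n, (N <= n)%N ->
  cmod (qprod n w - euler_prod w) <= e.
Proof. by rewrite /euler_prod; case: cid => l; exact. Qed.

Lemma euler_prod_unique w l : (forall e : R, 0 < e -> exists N, forall n, (N <= n)%N ->
  cmod (qprod n w - l) <= e) -> euler_prod w = l.
Proof.
move=> hl; apply/eqP; rewrite -subr_eq0 -cmod_eq0 eq_le cmod_ge0 andbT.
apply/ler_addgt0Pr => e e0; rewrite add0r; have e2 : 0 < e / 2 by lra.
have [N1 h1] := hl _ e2; have [N2 h2] := euler_prodP w e2.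
pose n := maxn N1 N2.
have -> : euler_prod w - l = (qprod n w - l) - (qprod n w - euler_prod w) by ring.
apply: le_trans (cmodB _ _) _.
have := h1 n (leq_maxl _ _); have := h2 n (leq_maxr _ _); lra.
Qed.

Lemma entire_euler_prod : entire euler_prod.
Proof.
apply: (weierstrass entire_qprod) => r e e0.
have [N hN] := geometric_small (K r) e0.
exists N => n Nn z zr; apply/ler_addgt0Pr => d d0.
have [M hM] := euler_prodP z d0; pose m := maxn n M.
have -> : qprod n z - euler_prod z =
  (qprod m z - euler_prod z) - (qprod m z - qprod n z) by ring.
apply: le_trans (cmodB _ _) _; rewrite addrC; apply: lerD; last first.
  by apply: hM; exact: leq_maxr.
have -> : m = (n + (m - n))%N by rewrite subnKC // leq_maxl.
by apply: le_trans (qprod_cauchy _ _ zr) _; exact: hN.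
Qed.

Lemma euler_prod_shift w : euler_prod w = (1 - w) * euler_prod (q * w).
Proof.
apply: euler_prod_unique => e e0.
have k0 : 0 < cmod (1 - w) + 1 by have := cmod_ge0 (1 - w); lra.
have [N hN] := euler_prodP (q * w) (divr_gt0 e0 k0).
exists N.+1 => -[//|n] /hN h; rewrite qprod_shift -mulrBr cmodM.
apply: le_trans (_ : (cmod (1 - w) + 1) * (e / (cmod (1 - w) + 1)) <= e).
  by apply: ler_pM; rewrite ?cmod_ge0 // lerDl.
by rewrite mulrC divfK ?gt_eqF.
Qed.

Lemma euler_prod0 : euler_prod 0 = 1.
Proof.
apply: euler_prod_unique => e e0; exists 0%N => n _.
rewrite /qprod big1 ?subrr ?cmod0 ?ltW // => i _.
by rewrite mulr0 subr0.
Qed.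

Lemma euler_prod_iter n w : euler_prod w = qprod n w * euler_prod (q ^+ n * w).
Proof.
elim: n => [|n IH]; first by rewrite /qprod big_ord0 !mul1r.
by rewrite IH qprodS (euler_prod_shift (q ^+ n * w)) exprS !mulrA.
Qed.

(** After enough factors are split off, the argument [q ^+ n * w] is so close to 0 that the
    remaining product is close to 1; a zero must come from the finite part. *)
Lemma euler_prod_eq0 w : euler_prod w = 0 -> exists k, q ^+ k * w = 1.
Proof.
have h12 : 0 < 1 / 2 :> R by lra.
have [d d0 hd] :=
  (continuousC _ _).1 (@entire_continuous _ _ entire_euler_prod 0) _ h12.
have [n hn] : exists n, cmod (q ^+ n * w) < d.
  have d2 : 0 < d / 2 by lra.
  have [N /(_ N (leqnn N)) h] := geometric_small (cmod w) d2.
  exists N; rewrite cmodM cmodX mulrC; apply: le_lt_trans h _; lra.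
have nz : euler_prod (q ^+ n * w) != 0.
  apply/eqP => h; have := hd (q ^+ n * w); rewrite subr0 => /(_ hn).
  by rewrite euler_prod0 h sub0r cmodN cmod1; lra.
rewrite (euler_prod_iter n) => /eqP; rewrite mulf_eq0 (negbTE nz) orbF.
by move=> /prodf_eq0[k _]; rewrite subr_eq0 => /eqP h; exists k.
Qed.

End EulerProduct.

(** * The theta function *)

Section Theta.
Context {R : realType}.
Local Notation C := (CC R).
Local Notation Re := complex.Re.
Local Notation Im := complex.Im.

Definition two_pi_i : C := ci * creal (pi *+ 2).

Lemma two_pi_i_neq0 : two_pi_i != 0.
Proof.
rewrite mulf_eq0 negb_or -cmod_eq0 cmod_ci oner_eq0 creal_eq0 /=.
by rewrite gt_eqF // mulrn_wgt0 // pi_gt0.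
Qed.

Definition e2pi (z : C) : C := cexp (two_pi_i * z).

Lemma e2piD z w : e2pi (z + w) = e2pi z * e2pi w.
Proof. by rewrite /e2pi mulrDr cexpD. Qed.

Lemma e2pi_neq0 z : e2pi z != 0. Proof. exact: cexp_neq0. Qed.

Lemma e2piN z : e2pi (- z) = (e2pi z)^-1.
Proof. by rewrite /e2pi mulrN cexpNV. Qed.

Lemma e2pi0 : e2pi 0 = 1. Proof. by rewrite /e2pi mulr0 cexp0. Qed.

Lemma e2pi1 : e2pi 1 = 1. Proof. by rewrite /e2pi mulr1 cexp_2pi. Qed.

Lemma e2pi_nat z n : e2pi (z * n%:R) = e2pi z ^+ n.
Proof. by rewrite /e2pi mulrA cexp_nat. Qed.

Lemma e2pi_eq1 z : e2pi z = 1 -> exists k : int, z = k%:~R.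
Proof.
by move=> /cexp_eq1[k h]; exists k; apply: (mulfI two_pi_i_neq0).
Qed.

Lemma e2pi_surj w : w != 0 -> exists z, e2pi z = w.
Proof.
move=> /cexp_surj[z hz]; exists (z / two_pi_i).
by rewrite /e2pi mulrC divfK // two_pi_i_neq0.
Qed.

Lemma entire_e2pi : entire e2pi.
Proof.
apply: (entire_comp (@entire_cexp R) (g := fun z => two_pi_i * z)).
exact: (entireM (@entire_cst _ _) (@entire_id R)).
Qed.

Lemma entire_opp : entire (-%R : C -> C).
Proof. by move=> z; exact: derivableN (@entire_id R z). Qed.

Lemma derive_e2pi0 : 'D_1 e2pi (0 : C) = two_pi_i.
Proof.
suff [] : is_derive (0 : C) 1 e2pi two_pi_i by [].
apply/is_deriveC => e e0.
have c0 : 0 < cmod two_pi_i by rewrite cmod_gt0 two_pi_i_neq0.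
have [d d0 hd] := cexp_small (divr_gt0 e0 c0).
exists (d / cmod two_pi_i); first by rewrite divr_gt0.
move=> w; rewrite subr0 ltr_pdivlMr // mulrC -cmodM => /hd.
rewrite e2pi0 cmodM; move=> /le_trans; apply.
by rewrite mulrA divfK ?gt_eqF.
Qed.

Variable tau : C.

Lemma lattice_ind (S : C -> Prop) : (forall a b, S a -> S b -> S (a + b)) ->
  (forall a, S a -> S (- a)) -> S 1 -> S tau ->
  forall lam, lattice tau lam -> S lam.
Proof.
move=> SD SN S1 St.
have S0 : S 0 by rewrite -(subrr 1); apply: SD => //; exact: SN.
have SZ a (n : int) : S a -> S (n%:~R * a).
  move=> Sa; have Snat (k : nat) : S (k%:R * a).
    by elim: k => [|k IH]; rewrite ?mul0r // mulrS mulrDl mul1r; exact: SD.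
  case: n => k; first by rewrite -pmulrn.
  by rewrite NegzE mulrNz mulNr -pmulrn; exact: SN.
move=> lam /asboolP[m [n ->]]; apply: SD; last exact: SZ.
by rewrite -[_%:~R]mulr1; exact: SZ.
Qed.

Hypothesis im_tau : 0 < Im tau.

Let q := e2pi tau.

Lemma cmod_nome : cmod q < 1.
Proof.
rewrite /q /e2pi cmod_cexp -expR0 ltr_expR /two_pi_i !ReImE.
rewrite !(mul0r, mulr0, mul1r, subr0, sub0r, addr0, add0r) oppr_lt0.
by rewrite mulr_gt0 // mulrn_wgt0 // pi_gt0.
Qed.

Local Notation P := (euler_prod cmod_nome).

(** Up to a constant and an exponential factor this is Jacobi's theta function in the form of the
    triple product, normalised to be 1-periodic and to vanish at the origin. *)
Definition theta (z : C) : C := P (e2pi z) * P (q * e2pi (- z)).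

Lemma entire_theta : entire theta.
Proof.
have eP := @entire_euler_prod _ _ cmod_nome.
apply: entireM; first exact: (entire_comp eP entire_e2pi).
apply: (entire_comp eP (g := fun z => q * e2pi (- z))).
apply: (entireM (@entire_cst _ _)).
exact: (entire_comp entire_e2pi entire_opp).
Qed.

Lemma theta1 z : theta (z + 1) = theta z.
Proof. by rewrite /theta opprD !e2piD !e2piN e2pi1 invr1 !mulr1. Qed.

(** With x = [e2pi z], the shift removes the factor 1 - x from the first product and adds 1 - 1 / x
    to the second. Both factors are written out, so that nothing is divided by 1 - x. *)
Lemma theta_tau z : theta (z + tau) = - e2pi (- z) * theta z.
Proof.
have e0 := e2pi_neq0 z; have q0 : q != 0 := e2pi_neq0 tau.
rewrite /theta opprD !e2piD !e2piN -/q.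
have -> : q * ((e2pi z)^-1 / q) = (e2pi z)^-1 by rewrite mulrC divfK.
rewrite (mulrC (e2pi z)) (euler_prod_shift _ (e2pi z)) (euler_prod_shift _ (e2pi z)^-1).
by field.
Qed.

(* The factor [1 - e2pi z] of [P (e2pi z)] carries the zero at the origin. *)
Lemma theta_factor : exists k, [/\ entire k, forall z, theta z = z * k z & k 0 != 0].
Proof.
have e1 : entire (fun z => 1 - e2pi z) := entireB (@entire_cst _ _) entire_e2pi.
have z1 : 1 - e2pi 0 = 0 by rewrite e2pi0 subrr.
have [k [ek kE k0]] := entire_factor e1 z1.
have eP := @entire_euler_prod _ _ cmod_nome.
exists (fun z => k z * (P (q * e2pi z) * P (q * e2pi (- z)))); split.
- apply: (entireM ek); apply: entireM.
    apply: (entire_comp eP (g := fun z => q * e2pi z)).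
    exact: (entireM (@entire_cst _ _) entire_e2pi).
  apply: (entire_comp eP (g := fun z => q * e2pi (- z))).
  apply: (entireM (@entire_cst _ _)).
  exact: (entire_comp entire_e2pi entire_opp).
- move=> z; rewrite /theta (euler_prod_shift _ (e2pi z)) kE subr0; ring.
have Pq : P q != 0.
  apply/eqP => /euler_prod_eq0[n] h.
  have := congr1 cmod h; rewrite cmodM cmodX cmod1 -exprSr => /eqP.
  rewrite lt_eqF // exprn_ilt1 ?cmod_ge0 //; exact: cmod_nome.
rewrite oppr0 e2pi0 mulr1 !mulf_neq0 // k0 (deriveBC _ (@entire_cst _ _) entire_e2pi).
by rewrite derive_cst sub0r oppr_eq0 derive_e2pi0 two_pi_i_neq0.
Qed.

(** The two products share the rows of the lattice: the first vanishes on the rows - n tau with n >=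
    0, the second on the rows (n + 1) tau. *)
Lemma theta_eq0_lattice z : theta z = 0 -> lattice tau z.
Proof.
have exq n : q ^+ n = e2pi (tau * n%:R) by rewrite e2pi_nat.
move=> /eqP; rewrite mulf_eq0 => /orP[] /eqP /euler_prod_eq0[n].
  rewrite exq -e2piD => /e2pi_eq1[k h]; apply/asboolP; exists k, (- n%:Z).
  by rewrite mulrNz mulNr -pmulrn -h; ring.
rewrite mulrA -exprSr exq -e2piD => /e2pi_eq1[k h]; apply/asboolP.
exists (- k), n.+1%:Z.
by rewrite mulrNz -pmulrn -h; ring.
Qed.

(** The exact factor is irrelevant: a nowhere vanishing one carries the simple zero at the origin to
    every lattice point, and such factors compose and invert. *)
Lemma theta_lattice (lam : C) : lattice tau lam ->
  exists u, [/\ entire u, forall z, u z != 0 &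
    forall z, theta (z + lam) = u z * theta z].
Proof.
move: lam; apply: lattice_ind.
- move=> a b [u [eu u0 hu]] [v [ev v0 hv]]; exists (fun z => v (z + a) * u z); split.
  + exact: (entireM (entire_shift ev) eu).
  + by move=> z; rewrite mulf_neq0.
  + by move=> z; rewrite addrA hv hu mulrA.
- move=> a [u [eu u0 hu]]; exists (fun z => (u (z - a))^-1); split.
  + move=> z; apply: derivableV; first exact: u0.
    exact: entire_shift.
  + by move=> z; rewrite invr_eq0.
  + by move=> z; have := hu (z - a); rewrite subrK => ->; rewrite mulKf.
- exists (fun=> 1); split; [exact: entire_cst|by move=> ?; rewrite oner_neq0|].
  by move=> z; rewrite theta1 mul1r.
- exists (fun z => - e2pi (- z)); split.
  + exact: (entire_comp entire_opp (entire_comp entire_e2pi entire_opp)).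
  + by move=> z; rewrite oppr_eq0 e2pi_neq0.
  + exact: theta_tau.
Qed.

Lemma theta_local (lam : C) : lattice tau lam ->
  exists k, [/\ entire k, forall z, theta z = (z - lam) * k z & k lam != 0].
Proof.
move=> /theta_lattice[u [eu u0 hu]]; have [k [ek kE k0]] := theta_factor.
exists (fun z => u (z - lam) * k (z - lam)); split.
- exact: (entireM (entire_shift eu) (entire_shift ek)).
- by move=> z; rewrite -{1}(subrK lam z) hu kE; ring.
- by rewrite subrr mulf_neq0.
Qed.

Lemma theta_eq0 z : lattice tau z -> theta z = 0.
Proof. by move=> /theta_local[k [_ -> _]]; rewrite subrr mul0r. Qed.

End Theta.

(** * The space of theta functions of given type *)

Section Gluing.
Context {R : realType}.
Local Notation C := (CC R).

Lemma punctured_eq (f g : C -> C) (z : C) :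
  {for z, continuous f} -> {for z, continuous g} ->
  (\forall w \near z^', f w = g w) -> f z = g z.
Proof.
move=> /continuousC cf /continuousC cg /dnearC[d d0 hd].
apply/eqP; rewrite -subr_eq0 -cmod_eq0 eq_le cmod_ge0 andbT.
apply/ler_addgt0Pr => e e0; rewrite add0r; have e2 : 0 < e / 2 by lra.
have [d1 d10 h1] := cf _ e2; have [d2 d20 h2] := cg _ e2.
pose r := Num.min d (Num.min d1 d2) / 2.
have m0 : 0 < Num.min d (Num.min d1 d2) by rewrite !lt_min d0 d10 d20.
have r0 : 0 < r by rewrite /r; lra.
have : r < Num.min d (Num.min d1 d2) by rewrite /r; lra.
rewrite !lt_min => /and3P[rd rd1 rd2].
have wz : cmod (z + creal r - z) = r.
  by rewrite addrAC subrr add0r cmod_creal ger0_norm // ltW.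
have wn : z + creal r != z.
  by rewrite -subr_eq0 -cmod_eq0 wz gt_eqF.
have E := hd (z + creal r); rewrite wz in E; have {}E := E rd wn.
have := h1 (z + creal r); rewrite wz => /(_ rd1).
have := h2 (z + creal r); rewrite wz => /(_ rd2); rewrite -E => A B.
have -> : f z - g z = (f (z + creal r) - g z) - (f (z + creal r) - f z) by ring.
by apply: le_trans (cmodB _ _) _; lra.
Qed.

(* [G] is holomorphic up to removable singularities; its values at the
   singularities are irrelevant. *)
Lemma entire_glue (G : C -> C) :
  (forall z : C, exists h : C -> C, (\forall w \near z, derivable h w 1) /\
    \forall w \near z^', G w = h w) ->
  exists2 H, entire H & forall z, \forall w \near z^', G w = H w.
Proof.
move=> /choice[h hP].
have ch z : {for z, continuous (h z)}.
  have [/nearC[d d0 hd] _] := hP z.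
  by apply: derivable_continuousC; apply: hd; rewrite subrr cmod0.
have uniq z k : {for z, continuous k} -> (\forall w \near z^', G w = k w) ->
    h z z = k z.
  move=> ck Gk; apply: (punctured_eq (ch z) ck).
  by have [_] := hP z; apply: filterS2 Gk => w -> ->.
(* Near z the diagonal w |-> h w w coincides with the single function [h z], hence is differentiable
   there. *)
have eqz z : \forall w \near z, h z w = h w w.
  have [/nearC[d1 d10 h1] /dnearC[d2 d20 h2]] := hP z.
  apply/nearC; exists (Num.min d1 d2); first by rewrite lt_min d10.
  move=> w; rewrite lt_min => /andP[w1 w2].
  have [->//|wz] := eqVneq w z.
  apply/esym/uniq; first exact/derivable_continuousC/h1.
  apply/dnearC.
  have wz0 : 0 < cmod (w - z) by rewrite cmod_gt0 subr_eq0.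
  exists (Num.min (d2 - cmod (w - z)) (cmod (w - z))).
    by rewrite lt_min wz0 subr_gt0 w2.
  move=> v; rewrite lt_min => /andP[v1 v2] _; apply: h2.
    have -> : v - z = (v - w) + (w - z) by ring.
    by apply: le_lt_trans (cmodD _ _) _; lra.
  by apply/eqP => vz; move: v2; rewrite vz cmod_distC ltxx.
exists (fun z => h z z) => z; last first.
  have [_ /dnearC[d d0 hd]] := hP z; have /nearC[d' d'0 hd'] := eqz z.
  apply/dnearC; exists (Num.min d d'); first by rewrite lt_min d0.
  by move=> w; rewrite lt_min => /andP[w1 w2] wz; rewrite hd // hd'.
have [/nearC[d1 d10 h1] _] := hP z.
have dz : derivable (h z) z 1 by apply: h1; rewrite subrr cmod0.
by move: (eqz z) dz => /near_eq_derivable; apply; rewrite ?oner_eq0.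
Qed.

Lemma near_neq0 (f : C -> C) z : {for z, continuous f} -> f z != 0 ->
  \forall w \near z, f w != 0.
Proof.
move=> /continuousC cf fz; have c0 : 0 < cmod (f z) by rewrite cmod_gt0.
have [d d0 hd] := cf _ c0; apply/nearC; exists d => // w /hd.
by apply: contraTneq => ->; rewrite sub0r cmodN ltxx.
Qed.

Lemma near_derivable_div (f g : C -> C) z : entire f -> entire g -> g z != 0 ->
  \forall w \near z, derivable (fun w => f w / g w) w 1.
Proof.
move=> ef eg gz; have := near_neq0 (@entire_continuous _ _ eg z) gz.
apply: filterS => w gw; apply: (derivableM (@ef w)).
exact: (derivableV gw (@eg w)).
Qed.

End Gluing.

(** * Division by theta and the dimension bound *)

Section ThetaFunctions.
Context {R : realType}.
Local Notation C := (CC R).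
Local Notation Re := complex.Re.
Local Notation Im := complex.Im.
Variable tau : C.
Hypothesis im_tau : 0 < Im tau.
Local Notation theta := (theta im_tau).

(** The sections of a line bundle of degree d on the torus, described by factors of automorphy.
    [theta] itself has d = 1 and c = -1. *)
Definition theta_type (d : nat) (c : C) (F : C -> C) :=
  [/\ entire F, forall z, F (z + 1) = F z &
    forall z, F (z + tau) = c * e2pi (- (d%:R * z)) * F z].

Lemma theta_type_lattice d c F lam : c != 0 -> theta_type d c F -> lattice tau lam ->
  forall z, F (z + lam) = 0 <-> F z = 0.
Proof.
move=> c0 [_ F1 Ft] hlam; move: lam hlam.
apply: lattice_ind => [a b Sa Sb z|a Sa z|z|z].
- by rewrite addrA Sb Sa.
- by rewrite -(Sa (z - a)) subrK.
- by rewrite F1.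
rewrite Ft; split=> [/eqP|->]; last by rewrite mulr0.
by rewrite !mulf_eq0 (negbTE c0) (negbTE (e2pi_neq0 _)) => /eqP.
Qed.

Lemma theta_shift_neq0 (p z : C) : \forall w \near z^', theta (w - p) != 0.
Proof.
have [h|h] := eqVneq (theta (z - p)) 0; last first.
  have ct : {for z, continuous (fun w => theta (w - p))}.
    exact: (@entire_continuous _ _ (entire_shift (@entire_theta _ _ im_tau)) z).
  have /nearC[d d0 hd] := near_neq0 ct h.
  by apply/dnearC; exists d => // w /hd.
have [k [ek kE k0]] := theta_local im_tau (theta_eq0_lattice h).
have /nearC[d d0 hd] := near_neq0 (@entire_continuous _ _ ek _) k0.
apply/dnearC; exists d => // w wz wn.
have E : w - p - (z - p) = w - z by ring.
by rewrite kE mulf_neq0 //; [rewrite E subr_eq0 | apply: hd; rewrite E].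
Qed.

Lemma theta_cancel (p : C) (A B : C -> C) : entire A -> entire B ->
  (forall z, A z * theta (z - p) = B z * theta (z - p)) -> A =1 B.
Proof.
move=> eA eB h z; apply: punctured_eq.
- exact: entire_continuous.
- exact: entire_continuous.
- have := theta_shift_neq0 p z; apply: filterS => w tw.
  exact: (mulIf tw).
Qed.

(** Zeros of [F] are invariant under the lattice, so [F] vanishes wherever [theta (z - p)] does, and
    the latter has simple zeros: the quotient extends. The new constant comes from the multiplier -
    e2pi (- z) * e2pi p of the denominator. *)
Lemma theta_div d c F p : c != 0 -> theta_type d.+1 c F -> F p = 0 ->
  exists2 K, theta_type d (- c * e2pi (- p)) K & forall z, F z = K z * theta (z - p).
Proof.
move=> c0 tF Fp; have [eF F1 Ft] := tF.
have et : entire (fun z => theta (z - p)) := entire_shift (@entire_theta _ _ im_tau).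
pose G z := F z / theta (z - p).
have zeros z : theta (z - p) = 0 -> F z = 0.
  move=> /theta_eq0_lattice h; have := theta_type_lattice c0 tF h p.
  by rewrite addrC subrK => ->.
have [z|H eH HP] := @entire_glue _ G.
  have [h|h] := eqVneq (theta (z - p)) 0; last first.
    exists G; split; last by apply/dnearC; exists 1.
    exact: near_derivable_div.
  have [k1 [ek1 k1E _]] := entire_factor eF (zeros z h).
  have [k2 [ek2 k2E k20]] := theta_local im_tau (theta_eq0_lattice h).
  have ek2' : entire (fun w => k2 (w - p)) := entire_shift ek2.
  exists (fun w => k1 w / k2 (w - p)); split.
    exact: near_derivable_div.
  apply/dnearC; exists 1 => // w _ wz; rewrite /G k1E k2E.
  have -> : w - p - (z - p) = w - z by ring.
  by rewrite -mulf_div divff ?mul1r // subr_eq0.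
have FE z : F z = H z * theta (z - p).
  have [h|h] := eqVneq (theta (z - p)) 0; first by rewrite zeros // h mulr0.
  suff <- : G z = H z by rewrite /G divfK.
  apply: punctured_eq (HP z); last exact: entire_continuous.
  apply: derivable_continuousC; have /nearC[d0 d00] := near_derivable_div eF et h.
  by apply; rewrite subrr cmod0.
exists H; last exact: FE.
split; first exact: eH.
(* The point is shifted back so that the factor cancelled is the denominator at the translated
   argument z + 1; likewise for tau below. *)
- apply: (@theta_cancel (p - 1) (fun z => H (z + 1)) H (entire_shift eH) eH).
  move=> z; have E : z - (p - 1) = z + 1 - p by ring.
  by rewrite E -FE F1 FE -(theta1 im_tau (z - p)) addrAC.
- apply: (@theta_cancel (p - tau) (fun z => H (z + tau)) _ (entire_shift eH)).
    apply: entireM eH; apply: (entireM (@entire_cst _ _)).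
    apply: (entire_comp (@entire_e2pi R) (g := fun z => - (d%:R * z))).
    apply: (entire_comp (@entire_opp R) (g := fun z => d%:R * z)).
    exact: (entireM (@entire_cst _ _) (@entire_id R)).
  move=> z; have E : z - (p - tau) = z + tau - p by ring.
  rewrite E -FE Ft FE.
  have -> : z + tau - p = (z - p) + tau by ring.
  rewrite theta_tau.
  have -> : e2pi (- (d.+1%:R * z)) = e2pi (- (d%:R * z)) * e2pi (- z).
    by rewrite -e2piD mulrSr; congr e2pi; ring.
  have -> : e2pi (- (z - p)) = e2pi (- z) * e2pi p by rewrite -e2piD; congr e2pi; ring.
  rewrite (e2piN p); have := e2pi_neq0 p; move: (e2pi p) => y y0.
  by field.
Qed.

(** Incongruence of the points keeps the divisor nonzero at the remaining ones, so the quotient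
    still vanishes there. *)
Lemma theta_divs (ps : seq C) c F : c != 0 -> theta_type (size ps) c F ->
  pairwise (fun p p' => theta (p' - p) != 0) ps -> (forall p, p \in ps -> F p = 0) ->
  exists2 K, theta_type 0 (c * \prod_(p <- ps) - e2pi (- p)) K &
    forall z, F z = K z * \prod_(p <- ps) theta (z - p).
Proof.
elim: ps c F => [|p ps IH] c F c0 tF.
  by exists F => [|z]; rewrite big_nil mulr1.
rewrite /= => /andP[/allP hp hps] Fps.
have [K tK KE] := theta_div c0 tF (Fps _ (mem_head _ _)).
have c'0 : - c * e2pi (- p) != 0 by rewrite mulf_neq0 ?oppr_eq0 ?e2pi_neq0.
have [p' hp'|L tL LE] := IH _ _ c'0 tK hps.
  have := KE p'; rewrite Fps ?inE ?hp' ?orbT // => /esym/eqP.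
  by rewrite mulf_eq0 (negbTE (hp _ hp')) orbF => /eqP.
exists L => [|z]; rewrite big_cons.
  by move: tL; congr theta_type; ring.
by rewrite KE LE; ring.
Qed.

Lemma theta_type0_eq0 K : theta_type 0 (-1) K -> forall z, K z = 0.
Proof.
move=> [eK K1 Kt].
have Ktau z : K (z + tau) = - K z by rewrite Kt mul0r oppr0 e2pi0 mulr1 mulN1r.
have Klat : forall lam, lattice tau lam -> forall z, cmod (K (z + lam)) = cmod (K z).
  apply: lattice_ind => [a b Sa Sb z|a Sa z|z|z].
  - by rewrite addrA Sb Sa.
  - by rewrite -(Sa (z - a)) subrK.
  - by rewrite K1.
  - by rewrite Ktau cmodN.
have [M hM] := continuous_bounded (1 + Im tau) (entire_continuous eK).
have bK z : cmod (K z) <= M.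
  (* The multiple of tau is removed first, since this also changes the real part. The remainder has
     real part in [0, 1) and imaginary part in [0, Im tau), inside the disc on which [M] was
     chosen. *)
  pose n := Num.floor (Im z / Im tau); pose z1 := z - n%:~R * tau.
  pose m := Num.floor (Re z1); pose z2 := z1 - m%:~R.
  have -> : z = z2 + (m%:~R + n%:~R * tau) by rewrite /z2 /z1; ring.
  rewrite Klat; last by apply/asboolP; exists m, n.
  apply: hM; apply: le_trans (cmod_le_ReIm _) _.
  have Imz2 : Im z2 = Im z - n%:~R * Im tau.
    by rewrite /z2 /z1 -!creal_int !ReImE; ring.
  have Rez2 : Re z2 = Re z1 - m%:~R by rewrite /z2 -!creal_int !ReImE.
  have n1 : n%:~R * Im tau <= Im z by rewrite -ler_pdivlMr //; exact: floor_le_tmp.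
  have n2 : Im z < (n + 1)%:~R * Im tau by rewrite -ltr_pdivrMr //; exact: floorD1_gt.
  have m1 : m%:~R <= Re z1 := floor_le_tmp _.
  have m2 : Re z1 < (m + 1)%:~R := floorD1_gt _.
  rewrite Imz2 Rez2; move: n2 m2; rewrite !intrD mulrDl !mul1r => n2 m2.
  by rewrite !ger0_norm ?subr_ge0 //; lra.
move=> z; have := Ktau z; rewrite (liouville eK bK (z + tau) z) => /eqP.
rewrite -subr_eq0 opprK -mulr2n -mulr_natl mulf_eq0 => /orP[|/eqP //].
by rewrite -(creal_nat 2) creal_eq0 pnatr_eq0.
Qed.

Lemma theta_frac_neq0 (d i j : nat) : (i < j < d)%N ->
  theta ((j%:R - i%:R) / d%:R) != 0.
Proof.
move=> /andP[ij jd]; apply/eqP => /theta_eq0_lattice /asboolP[m [n]].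
have -> : (j%:R - i%:R) / d%:R = creal ((j%:R - i%:R) / d%:R) :> C.
  by rewrite crealM crealV crealD crealN !creal_nat.
rewrite -!creal_int => h.
have := congr1 (@complex.Im R) h; have := congr1 (@complex.Re R) h.
rewrite !ReImE !mul0r add0r addr0 subr0 => hR /esym/eqP.
rewrite mulf_eq0 (gt_eqF im_tau) orbF => /eqP n0; move: hR.
rewrite n0 mul0r addr0.
have d0 : 0 < d%:R :> R by rewrite ltr0n; case: (d) jd.
have ijR : i%:R < j%:R :> R by rewrite ltr_nat.
have jdR : j%:R < d%:R :> R by rewrite ltr_nat.
have i0 : 0 <= i%:R :> R by [].
move=> hm.
have : 0 < m%:~R :> R by rewrite -hm divr_gt0 // subr_gt0.
have : m%:~R < 1 :> R by rewrite -hm ltr_pdivrMr // mul1r; lra.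
by rewrite ltr0z ltrz1; case: (m) => // -[].
Qed.

Lemma entire_sum m (F : 'I_m -> C -> C) : (forall i, entire (F i)) ->
  entire (fun z => \sum_i F i z).
Proof.
elim: m F => [|m IH] F eF.
  have -> : (fun z => \sum_i F i z) = fun=> 0.
    by apply/funext => z; rewrite big_ord0.
  exact: entire_cst.
have -> : (fun z => \sum_i F i z) =
    fun z => F ord0 z + \sum_(i < m) F (lift ord0 i) z.
  by apply/funext => z; rewrite big_ord_recl.
exact: (entireD (eF ord0) (IH _ (fun i => eF (lift ord0 i)))).
Qed.

Lemma theta_type_sum d c m (F : 'I_m -> C -> C) (a : 'I_m -> C) :
  (forall j, theta_type d c (F j)) ->
  theta_type d c (fun z => \sum_j a j * F j z).
Proof.
move=> tF; split.
- apply: entire_sum => i; have [eF _ _] := tF i.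
  exact: (entireM (@entire_cst _ _) eF).
- by move=> z; apply: eq_bigr => i _; have [_ -> _] := tF i.
- move=> z; rewrite mulr_sumr; apply: eq_bigr => i _; have [_ _ ->] := tF i.
  by rewrite mulrCA.
Qed.

(* The points are equally spaced, so that they are incongruent modulo the
   lattice, and translated so that the quotient by the product of the theta
   functions is antiperiodic in the direction tau. *)
Lemma theta_type_dep (n : nat) c (F : 'I_n.+2 -> C -> C) : c != 0 ->
  (forall j, theta_type n.+1 c (F j)) ->
  exists2 a : 'rV[C]_n.+2, a != 0 & forall z, \sum_j a 0 j * F j z = 0.
Proof.
move=> c0 tF; set d := n.+1.
(* [A] is the constant left after division at the unshifted points. Shifting them by [p0] multiplies
   it by e2pi (- d p0), which has to equal - 1 / A; this determines [y] = - d p0. *)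
pose A : C := c * \prod_(i < d) - e2pi (- (i%:R / d%:R)).
have dn : d%:R != 0 :> C by rewrite -creal_nat creal_eq0 pnatr_eq0.
have A0 : A != 0.
  by rewrite mulf_neq0 //; apply/prodf_neq0 => i _; rewrite oppr_eq0 e2pi_neq0.
have B0 : - A^-1 != 0 by rewrite oppr_eq0 invr_eq0.
have [y hy] := e2pi_surj B0.
pose p0 := - (y / d%:R); pose pt (i : nat) : C := i%:R / d%:R + p0.
(* Values at the points: one more row than columns, so the left kernel holds a nonzero vector. *)
pose M : 'M[C]_(d.+1, d) := \matrix_(j, i) F j (pt i).
have kM : kermx M != 0.
  rewrite kermx_eq0 /row_free; apply: contraTneq isT => rM.
  by have := rank_leq_col M; rewrite rM ltnn.
pose a := nz_row (kermx M).
have a0 : a != 0 by rewrite nz_row_eq0.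
have aM : a *m M = 0 by apply/sub_kermxP; exact: nz_row_sub.
exists a => //; pose G z := \sum_j a 0 j * F j z.
have tG : theta_type d c G := theta_type_sum _ tF.
pose ps := mkseq pt d.
have szps : size ps = d by rewrite size_mkseq.
have Gps p : p \in ps -> G p = 0.
  move=> /mapP[k]; rewrite mem_iota add0n /= => kd ->.
  have := congr1 (fun N : 'rV_d => N 0 (Ordinal kd)) aM; rewrite !mxE => <-.
  by apply: eq_bigr => j _; rewrite !mxE.
have pw : pairwise (fun p p' => theta (p' - p) != 0) ps.
  apply/(pairwiseP 0) => i j; rewrite !inE szps => id jd ij.
  rewrite !nth_mkseq //.
  have -> : pt j - pt i = (j%:R - i%:R) / d%:R by rewrite /pt; ring.
  by apply: theta_frac_neq0; rewrite ij jd.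
have [|K tK KE] := theta_divs c0 _ pw Gps; first by rewrite szps.
have cK : c * \prod_(p <- ps) - e2pi (- p) = -1.
  rewrite /ps /mkseq big_map -{1}[d]subn0 -/(index_iota 0 d) big_mkord.
  have -> : \prod_(i < d) - e2pi (- pt i) =
      \prod_(i < d) (- e2pi (- (i%:R / d%:R)) * e2pi (- p0)).
    by apply: eq_bigr => i _; rewrite /pt opprD e2piD mulNr.
  rewrite big_split /= prodr_const card_ord -e2pi_nat mulrA -/A.
  have -> : - p0 * d%:R = y by rewrite /p0 opprK divfK.
  by rewrite hy mulrN divff.
rewrite cK in tK => z.
by have := KE z; rewrite (theta_type0_eq0 tK) mul0r.
Qed.

End ThetaFunctions.

(** * Divisors on the torus *)

Section Torus.
Context {R : realType}.
Local Notation C := (CC R).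
Variable tau : C.
Local Notation T := (torus tau).

Lemma torus_pi_eq (z w : C) : \pi_T z = \pi_T w <-> lattice tau (z - w).
Proof.
have -> : lattice tau (z - w) = (z - w \in lattice tau) by [].
rewrite Quotient.idealrBE; split=> [h|/eqP]; last exact.
by apply/eqP; exact: h.
Qed.

Lemma torus_pi_lattice (z lam : C) : lattice tau lam -> \pi_T (z + lam) = \pi_T z.
Proof. by move=> h; apply/torus_pi_eq; rewrite addrAC subrr add0r. Qed.

Lemma torus_piD (z w : C) : \pi_T (z + w) = \pi_T z + \pi_T w.
Proof. exact: (@Quotient.pi_add _ (lattice tau)). Qed.

Lemma lattice1 : lattice tau 1.
Proof. by apply/asboolP; exists 1, 0; rewrite mul0r addr0. Qed.

Lemma lattice_tau : lattice tau tau.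
Proof. by apply/asboolP; exists 0, 1; rewrite mul1r add0r. Qed.

Lemma near_torus (U : set T) (z : C) : open U -> U (\pi_T z) ->
  \forall w \near z, U (\pi_T w).
Proof. by move=> oU Uz; have : nbhs z (\pi_T @^-1` U) by apply: open_nbhs_nbhs. Qed.

End Torus.

(** * Orders, and theta products with a given divisor *)

Section Orders.
Context {R : realType}.
Local Notation C := (CC R).

Lemma derivable_exprz (g : C -> C) (z : C) (m : int) : derivable g z 1 -> g z != 0 ->
  derivable (fun w => g w ^ m) z 1.
Proof.
move=> dg gz.
have H (k : nat) : derivable (fun w => g w ^+ k) z 1.
  elim: k => [|k IH]; first exact: derivable_cst.
  have -> : (fun w => g w ^+ k.+1) = (fun w => g w * g w ^+ k).
    by apply/funext => w; rewrite exprS.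
  exact: derivableM dg IH.
case: m => k; first exact: H.
by rewrite NegzE; apply: derivableV (H k.+1); rewrite expf_neq0.
Qed.

Lemma has_orderM (F G : C -> C) z k m : has_order F z k -> has_order G z m ->
  has_order (fun w => F w * G w) z (k + m).
Proof.
move=> [f [df f0 hf]] [g [dg g0 hg]]; exists (fun w => f w * g w); split.
- by apply: filterS2 dg df => w dg df; exact: derivableM df dg.
- exact: mulf_neq0.
move/dnearC: hf => [d d0 hd]; move/dnearC: hg => [d' d'0 hd'].
apply/dnearC; exists (Num.min d d'); first by rewrite lt_min d0.
move=> w; rewrite lt_min => /andP[w1 w2] wz; rewrite hd // hd' //.
by rewrite expfzDr ?subr_eq0 //; ring.
Qed.

Lemma has_order_exprz (F : C -> C) z k m : has_order F z k ->
  has_order (fun w => F w ^ m) z (k * m).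
Proof.
move=> [f [df f0 hf]]; exists (fun w => f w ^ m); split.
- have cf : {for z, continuous f}.
    apply: derivable_continuousC; move/nearC: df => [d d0 hd].
    by apply: hd; rewrite subrr cmod0.
  by apply: filterS2 (near_neq0 cf f0) df => w fw dfw; exact: derivable_exprz.
- exact: expfz_neq0.
- by apply: filterS hf => w ->; rewrite expfzMl exprz_exp.
Qed.

Lemma has_order0 (F : C -> C) z : entire F -> F z != 0 -> has_order F z 0.
Proof.
move=> eF Fz; exists F; split=> //.
- by apply/nearC; exists 1.
- by apply/dnearC; exists 1 => // w _ _; rewrite expr0z mul1r.
Qed.

Lemma has_order_prod (I : Type) (r : seq I) (F : I -> C -> C) (k : I -> int) z :
  (forall i, has_order (F i) z (k i)) ->
  has_order (fun w => \prod_(i <- r) F i w) z (\sum_(i <- r) k i).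
Proof.
move=> h; elim: r => [|i r IH].
  have -> : (fun w => \prod_(i <- [::]) F i w) = fun=> 1.
    by apply/funext => w; rewrite big_nil.
  by rewrite big_nil; apply: has_order0; [exact: entire_cst | exact: oner_neq0].
have -> : (fun w => \prod_(i <- i :: r) F i w) =
    fun w => F i w * \prod_(i <- r) F i w.
  by apply/funext => w; rewrite big_cons.
by rewrite big_cons; exact: has_orderM.
Qed.

Variable tau : C.
Hypothesis im_tau : 0 < complex.Im tau.
Local Notation theta := (theta im_tau).
Local Notation T := (torus tau).

Lemma theta_order (p z : C) :
  has_order (fun w => theta (w - p)) z (if \pi_T p == \pi_T z then 1 else 0).
Proof.
have [h|h] := eqVneq (theta (z - p)) 0.
  have hl := theta_eq0_lattice h.
  have -> : \pi_T p == \pi_T z by apply/eqP/esym/torus_pi_eq.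
  have [k [ek kE k0]] := theta_local im_tau hl.
  exists (fun w => k (w - p)); split=> //.
  - by apply/nearC; exists 1 => // w _; exact: entire_shift ek w.
  - apply/dnearC; exists 1 => // w _ _; rewrite kE expr1z.
    by congr (_ * _); ring.
have -> : (\pi_T p == \pi_T z) = false.
  apply: contraNF h => /eqP/esym/torus_pi_eq hl; apply/eqP.
  exact: theta_eq0.
exact: (has_order0 (entire_shift (@entire_theta _ _ im_tau)) h).
Qed.

(** Each factor contributes the power [D u] of its own constant and of [e2pi (- z)]; the latter
    powers add up to the degree. *)
Lemma theta_divisor (D : T -> int) (d : nat) : finite_set [set u | D u != 0] ->
  \sum_(u \in [set: T]) D u = d%:Z ->
  exists c F, [/\ c != 0, forall z, has_order F z (D (\pi_T z)),
    forall z, F (z + 1) = F z &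
    forall z, F (z + tau) = c * e2pi (- (d%:R * z)) * F z].
Proof.
move=> /finite_seqP[s0 sD] sumD.
pose s := undup s0.
have memD u : u \notin s -> D u = 0.
  rewrite mem_undup => us; apply: contrapT => /eqP Du.
  by have : [set u | D u != 0] u by []; rewrite sD /= (negbTE us).
have {}sumD : \sum_(u <- s) D u = d%:Z.
  rewrite -sumD (fsbigE s) ?undup_uniq //; last by move=> u _; exact: memD.
  by apply: eq_bigl => u; rewrite in_setT.
(* At a pole the convention 0^-1 = 0 gives [F] a value for which both functional equations still
   hold, so they need no exception. *)
pose F z := \prod_(u <- s) theta (z - repr u) ^ (D u).
exists (\prod_(u <- s) (- e2pi (repr u)) ^ (D u)), F; split.
- rewrite prodf_seq_neq0; apply/allP => u _.
  by rewrite /= expfz_neq0 // oppr_eq0 e2pi_neq0.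
- move=> z; have -> : D (\pi_T z) =
      \sum_(u <- s) (if \pi_T (repr u) == \pi_T z then 1 else 0) * D u.
    under eq_bigr do rewrite reprK.
    have [zs|zs] := boolP (\pi_T z \in s).
      rewrite (bigD1_seq (\pi_T z)) ?undup_uniq //= eqxx mul1r big1 ?addr0 //.
      by move=> u /negbTE ->; rewrite mul0r.
    rewrite memD // big1_seq // => u /= us.
    by case: eqVneq us zs => [->->//|]; rewrite mul0r.
  apply: (@has_order_prod _ s (fun u w => theta (w - repr u) ^ (D u))) => u.
  exact: has_order_exprz (theta_order _ _).
- move=> z; apply: eq_bigr => u _.
  by rewrite addrAC (theta1 im_tau (z - repr u)).
move=> z; have -> : e2pi (- (d%:R * z)) = \prod_(u <- s) e2pi (- z) ^ (D u).
  have -> : \prod_(u <- s) e2pi (- z) ^ (D u) = e2pi (- z) ^ (\sum_(u <- s) D u).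
    elim: (s) => [|u r IH]; first by rewrite !big_nil expr0z.
    by rewrite !big_cons IH expfzDr // e2pi_neq0.
  by rewrite sumD -exprnP -e2pi_nat; congr e2pi; ring.
rewrite -!big_split /=; apply: eq_bigr => u _.
have -> : z + tau - repr u = z - repr u + tau by rewrite addrAC.
have -> : theta (z - repr u + tau) = - e2pi (repr u) * e2pi (- z) * theta (z - repr u).
  by rewrite theta_tau opprB e2piD !mulNr.
by rewrite (expfzMl _ (theta (z - repr u))) (expfzMl _ (e2pi (- z))).
Qed.

End Orders.

(** * Lifting an embedding *)

Section Lift.
Context {R : realType}.
Local Notation C := (CC R).
Variable tau : C.
Hypothesis im_tau : 0 < complex.Im tau.
Local Notation T := (torus tau).

Lemma near_dnear_shift (P : C -> Prop) (z a : C) :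
  (\forall w \near (z + a)^', P w) -> \forall w \near z^', P (w + a).
Proof.
move=> /dnearC[d d0 hd]; apply/dnearC; exists d => // w wz wn; apply: hd.
  by have -> : w + a - (z + a) = w - z by ring.
by rewrite (inj_eq (addIr a)).
Qed.

(* If the section s has divisor D and F is a product of translates of theta with
   divisor D, then the functions (x_j / s) * F have no poles and no common
   zero. *)
Lemma embedding_lift (n d : nat) (f : T -> projspace R n) (fh : holomorphic_map f) :
  has_degree (pullback_O1 fh) d%:Z ->
  exists c (Phi : 'I_n.+1 -> C -> C), [/\ c != 0, forall j, theta_type tau d c (Phi j) &
    forall z, proportional (hcoord (f (\pi_T z))) (\col_j Phi j z)].
Proof.
move=> [s [D [[sE sD finD] sumD]]].
have [c [TD [c0 TDo TD1 TDt]]] := theta_divisor im_tau finD sumD.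
have /choice[ch chP] : forall u : T, exists i, chart i (f u).
  by move=> u; exact: chart_cover.
pose G j (w : C) : C :=
  let u := \pi_T w in affcoord (ch u) j (f u) / s (ch u) u * TD w.
(* The choice of chart is immaterial: the transition function of the section cancels the change of
   denominator in the affine coordinate. *)
have GE j w i : chart i (f (\pi_T w)) ->
    G j w = affcoord i j (f (\pi_T w)) / s i (\pi_T w) * TD w.
  move=> hi; rewrite /G /=; congr (_ * _).
  have hc := chP (\pi_T w); rewrite (sE i _ _ hi hc) /= /affcoord invfM invf_div.
  by rewrite mulrA; congr (_ / _); rewrite mulrA divfK.
have loc (z : C) : exists (i : 'I_n.+1) (g h : C -> C),
    [/\ chart i (f (\pi_T z)), g z != 0, h z != 0 &
    [/\ \forall w \near z, derivable g w 1, \forall w \near z, derivable h w 1,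
      \forall w \near z, chart i (f (\pi_T w)) &
      \forall w \near z^', forall j,
        G j w = affcoord i j (f (\pi_T w)) / g w * h w]].
  have hi := chP (\pi_T z); set i := ch _ in hi.
  have [g [dg g0 gE]] := sD i _ hi z erefl.
  have [h [dh h0 hE]] := TDo z.
  exists i, g, h; split => //.
  have ci : \forall w \near z, chart i (f (\pi_T w)).
    exact: (near_torus (@lb_dom_open _ _ (pullback_O1 fh) i)).
  split => //.
  move/dnearC: gE => [d1 d10 gE]; move/dnearC: hE => [d2 d20 hE].
  move/nearC: ci => [d3 d30 ci]; apply/dnearC.
  exists (Num.min d1 (Num.min d2 d3)); first by rewrite !lt_min d10 d20.
  move=> w; rewrite !lt_min => /and3P[w1 w2 w3] wz j.
  rewrite (GE j w i (ci w w3)) hE //.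
  have := gE w w1 wz; rewrite /= => ->.
  have : (w - z) ^ D (\pi_T z) != 0 by rewrite expfz_neq0 // subr_eq0.
  move: (_ ^ _) => y y0; rewrite invfM.
  by move: (affcoord _ _ _) (g w)^-1 (h w) => A B E; field.
have /choice[Phi PhiP] : forall j, exists H, entire H /\
    forall z, \forall w \near z^', G j w = H w.
  move=> j; have [z|H eH HP] := @entire_glue _ (G j); last by exists H.
  have [i [g [h [hi g0 h0 [dg dh ci GEz]]]]] := loc z.
  exists (fun w => affcoord i j (f (\pi_T w)) / g w * h w); split; last first.
    by apply: filterS GEz => w; exact.
  have cg : {for z, continuous g}.
    apply: derivable_continuousC; move/nearC: dg => [e e0]; apply.
    by rewrite subrr cmod0.
  have cgw : \forall w \near z, chart i (f (\pi_T w)) /\ g w != 0.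
    exact: filterI ci (near_neq0 cg g0).
  apply: filterS3 dg dh cgw => w dgw dhw [cw gw].
  exact: (derivableM (derivableM (fh.2 i j w cw) (derivableV gw dgw)) dhw).
(* At z itself all coordinates share the nonzero factor h / g, so they are homogeneous coordinates
   of the image point and cannot vanish together. *)
have PhiE (z : C) : exists (i : 'I_n.+1) (g h : C),
    [/\ chart i (f (\pi_T z)), g != 0, h != 0 &
    forall j, Phi j z = affcoord i j (f (\pi_T z)) / g * h :> C].
  have [i [g [h [hi g0 h0 [dg dh ci GEz]]]]] := loc z.
  exists i, (g z), (h z); split=> // j; have [ePhi Phij] := PhiP j.
  have dz (k : C -> C) : (\forall w \near z, derivable k w 1) -> derivable k z 1.
    by move/nearC => [e e0]; apply; rewrite subrr cmod0.
  apply: (@punctured_eq _ (Phi j)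
    (fun w => affcoord i j (f (\pi_T w)) / g w * h w)).
  - exact: entire_continuous.
  - apply: derivable_continuousC.
    have dgV := derivableV g0 (dz _ dg).
    exact: (derivableM (derivableM (fh.2 i j z hi) dgV) (dz _ dh)).
  - by apply: filterS2 GEz (Phij z) => w -> <-.
exists c, Phi; split=> // [j|z].
  have [ePhi Phij] := PhiP j; split=> // z.
  - apply: (@punctured_eq _ (fun w => Phi j (w + 1)) (Phi j)).
    + exact: (@entire_continuous _ _ (entire_shift ePhi)).
    + exact: entire_continuous.
    + apply: filterS2 (near_dnear_shift (Phij (z + 1))) (Phij z) => w <- <-.
      by rewrite /G torus_pi_lattice ?TD1 //; exact: lattice1.
  - have eu : entire (fun w => c * e2pi (- (d%:R * w))).
      apply: (entireM (@entire_cst _ _)).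
      apply: (entire_comp (@entire_e2pi R) (g := fun z => - (d%:R * z))).
      apply: (entire_comp (@entire_opp R) (g := fun z => d%:R * z)).
      exact: (entireM (@entire_cst _ _) (@entire_id R)).
    apply: (@punctured_eq _ (fun w => Phi j (w + tau))
      (fun w => c * e2pi (- (d%:R * w)) * Phi j w)).
    + exact: (@entire_continuous _ _ (entire_shift ePhi)).
    + exact: (@entire_continuous _ _ (entireM eu ePhi)).
    + apply: filterS2 (near_dnear_shift (Phij (z + tau))) (Phij z) => w <- <-.
      rewrite /G torus_pi_lattice; last exact: lattice_tau.
      by rewrite TDt mulrCA.
have [i [g [h [hi g0 h0 E]]]] := PhiE z.
exists (g * hcoord (f (\pi_T z)) i 0 / h).
  by rewrite !mulf_neq0 ?invr_eq0.
apply/colP => j; rewrite !mxE E /affcoord.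
have hi' : hcoord (f (\pi_T z)) i 0 != 0 by exact: hi.
by field; rewrite h0 g0 hi'.
Qed.

End Lift.

(** * The projective transformation *)

Section Final.
Context {R : realType}.
Local Notation C := (CC R).

Lemma projspace_eq n (p p' : projspace R n) :
  proportional (hcoord p) (hcoord p') -> p = p'.
Proof.
move=> h; rewrite -[p](@reprK _ {eq_quot same_line}).
rewrite -[p'](@reprK _ {eq_quot same_line}).
by apply/eqmodP; apply/asboolP.
Qed.

Lemma projspace_of n (v : 'cV[C]_n.+1) : v != 0 ->
  exists p : projspace R n, proportional (hcoord p) v.
Proof.
move=> v0; have hv : v \in [set v : 'cV[C]_n.+1 | v != 0] by rewrite inE.
exists (\pi_{eq_quot same_line} (SigSub hv : nzvec)).
exact: hcoord_pi.
Qed.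

Lemma projective_transformation_of n (M : 'M[C]_n.+1) : M \in unitmx ->
  exists2 G : projspace R n -> projspace R n, is_projective_transformation G &
    forall p, proportional (hcoord (G p)) (M *m hcoord p).
Proof.
move=> uM.
have /choice[G hG] : forall p : projspace R n, exists p' : projspace R n,
    proportional (hcoord p') (M *m hcoord p).
  move=> p; apply: projspace_of; apply: contra_neq (hcoord_neq0 p) => h.
  by rewrite -(mulKmx uM (hcoord p)) h mulmx0.
by exists G => //; exists M.
Qed.

Variable tau : C.
Local Notation T := (torus tau).

(** A linear relation between the lifted coordinates is the equation of a hyperplane containing the
    image. *)
Lemma hyperplane_coord n (f : T -> projspace R n) (Phi : 'I_n.+1 -> C -> C) :
  in_no_hyperplane f ->
  (forall z, proportional (hcoord (f (\pi_T z))) (\col_j Phi j z)) ->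
  forall a : 'rV[C]_n.+1, (forall z, \sum_j a 0 j * Phi j z = 0) -> a = 0.
Proof.
move=> nf hPhi a ha; apply: contrapT => /eqP a0; apply: (nf a a0) => _ [u _ <-].
rewrite /hyperplane /= -[u]reprK; have [k k0 ->] := hPhi (repr u).
rewrite -scalemxAr; apply/rowP => j; rewrite !mxE (_ : \sum_(_ < _) _ = 0) ?mulr0 //.
by rewrite -[RHS](ha (repr u)); apply: eq_bigr => i _; rewrite !mxE.
Qed.

Lemma theta_type_translate d c c' (F : C -> C) (a : C) : theta_type tau d c' F ->
  c' * e2pi (- (d%:R * a)) = c -> theta_type tau d c (fun z => F (z + a)).
Proof.
move=> [eF F1 Ft] <-; split=> [|z|z]; first exact: entire_shift.
- by rewrite addrAC F1.
- rewrite addrAC Ft mulrDr opprD e2piD; ring.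
Qed.

End Final.

Theorem proposition3p1 (R : realType) (tau : CC R) (n : nat)
    (im_tau : 0 < complex.Im tau)
    (iota iota' : embedding tau n)
    (deg_iota : embedding_has_degree iota n.+1%:Z)
    (deg_iota' : embedding_has_degree iota' n.+1%:Z)
    (span_iota : in_no_hyperplane iota)
    (span_iota' : in_no_hyperplane iota') :
  exists (sigma : torus tau -> torus tau)
         (G : projspace R n -> projspace R n),
    [/\ is_translation sigma, is_projective_transformation G
      & G \o iota = iota' \o sigma].
Proof.
have [c [Phi [c0 tPhi hPhi]]] := embedding_lift im_tau deg_iota.
have [c' [Phi' [c'0 tPhi' hPhi']]] := embedding_lift im_tau deg_iota'.
have [y hy] := e2pi_surj (mulf_neq0 c0 (invr_neq0 c'0)).
have dn : n.+1%:R != 0 :> CC R by rewrite -creal_nat creal_eq0 pnatr_eq0.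
(* Translation by a multiplies c' by e2pi (- (n + 1) a) = e2pi y = c / c'. *)
pose a := - (y / n.+1%:R).
have ca : c' * e2pi (- (n.+1%:R * a)) = c.
  have -> : - (n.+1%:R * a) = y by rewrite /a mulrN opprK mulrC divfK.
  by rewrite hy mulrC divfK.
pose Psi j z := Phi' j (z + a).
have tPsi j : theta_type tau n.+1 c (Psi j) := theta_type_translate (tPhi' j) ca.
have free := hyperplane_coord span_iota hPhi.
have free' := hyperplane_coord span_iota' hPhi'.
have /choice[M hM] : forall j, exists m : 'rV[CC R]_n.+1,
    forall z, Psi j z = \sum_k m 0 k * Phi k z.
  (* [Psi j] together with the n + 1 functions [Phi] is one function too many. The coefficient of
     [Psi j] in the resulting relation is nonzero because the [Phi] are free, so [Psi j] can be
     solved for. *)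
  move=> j; pose F (k : 'I_n.+2) := if unlift ord0 k is Some k' then Phi k' else Psi j.
  have F0 : F ord0 = Psi j by rewrite /F unlift_none.
  have FS k : F (lift ord0 k) = Phi k by rewrite /F liftK.
  have tF k : theta_type tau n.+1 c (F k) by rewrite /F; case: unlift.
  have [b b0 hb] := theta_type_dep im_tau c0 tF.
  have hb' z : b 0 ord0 * Psi j z + \sum_k b 0 (lift ord0 k) * Phi k z = 0.
    rewrite -[RHS](hb z) [RHS]big_ord_recl F0; congr (_ + _).
    by apply: eq_bigr => k _; rewrite FS.
  have b00 : b 0 ord0 != 0.
    apply: contra_neq b0 => b00.
    have /free : forall z, \sum_k (\row_k b 0 (lift ord0 k)) 0 k * Phi k z = 0.
      move=> z; rewrite -[RHS](hb' z) b00 mul0r add0r.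
      by apply: eq_bigr => k _; rewrite mxE.
    move=> /rowP br; apply/rowP => k; rewrite mxE.
    have [k' ->|->] := unliftP ord0 k; last exact: b00.
    by have := br k'; rewrite !mxE.
  exists (\row_k (- (b 0 ord0)^-1 * b 0 (lift ord0 k))) => z.
  apply: (mulfI b00); have /eqP := hb' z; rewrite addr_eq0 => /eqP ->.
  rewrite mulr_sumr -sumrN; apply: eq_bigr => k _; rewrite mxE.
  by field.
pose N : 'M[CC R]_n.+1 := \matrix_(j, k) M j 0 k.
have uN : N \in unitmx.
  rewrite -row_free_unit -kermx_eq0; apply: contrapT => /negP kN.
  have : nz_row (kermx N) != 0 by rewrite nz_row_eq0.
  case/negP; apply/eqP; apply: free' => z; set b := nz_row _.
  have bN : b *m N = 0 by apply/sub_kermxP; exact: nz_row_sub.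
  (* A row vector in the left kernel of [N] is a relation between the [Psi]; reading it at z - a
     undoes the translation and gives a relation between the [Phi']. *)
  rewrite -(subrK a z).
  under eq_bigr => j _.
    rewrite -/(Psi j (z - a)) hM mulr_sumr.
    over.
  rewrite exchange_big big1 // => k _.
  under eq_bigr do rewrite mulrA.
  rewrite -mulr_suml (_ : \sum_(_ < _) _ = 0) ?mul0r //.
  have := congr1 (fun B : 'rV_n.+1 => B 0 k) bN; rewrite !mxE => h; rewrite -[RHS]h.
  by apply: eq_bigr => j _; rewrite mxE.
have [G pG hG] := projective_transformation_of uN.
exists (fun u => u + \pi_(torus tau) a), G.
split=> //; first by exists (\pi_(torus tau) a).
apply/funext => u; rewrite /= -[u]reprK -torus_piD; set z := repr u.
apply: projspace_eq.
apply: proportional_trans (hG _) _.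
apply: proportional_trans (proportional_sym (hPhi' (z + a))).
have [k k0 ->] := hPhi z; exists k => //; rewrite -scalemxAr; congr (_ *: _).
apply/colP => j; rewrite !mxE -/(Psi j z) hM.
by apply: eq_bigr => i _; rewrite !mxE.
Qed.
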